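(* Assume that $H$ is a Gorenstein ring and endow $\mathrm{Rep}^\infty_k(G)$ with the $I$-Gorenstein projective model structure. Let $V,W\in\mathrm{Rep}^\infty_k(G)$ with $V$ cofibrant. If $f,g\in\mathrm{Hom}_G(V,W)$ then $f$ and $g$ are homotopic if and only if $g-f$ factors through an $I$-projective $G$-representation.
   Context: Let $k$ be a field of characteristic $p>0$ and $G$ a topological group (possibly discrete) admitting an open pro-$p$ subgroup $I$. $\mathrm{Rep}_k^\infty(G)$ is the category of smooth $k$-linear $G$-representations (stabilizers of vectors are open). $\mathbb{X}=\mathrm{ind}_I^G(k)$ is the space of compactly supported $f:G\to k$ with $f(gi)=f(g)$ for $i\in I$, with action $(gf)(g')=f(g^{-1}g')$; $H=\mathrm{End}_G(\mathbb{X})^{\mathrm{op}}$; $\mathrm{Mod}(H)$ is the category of left $H$-modules; $F=\mathbb{X}\otimes_H(\cdot)$ is left adjoint to $U=(\cdot)^I$. A $G$-representation is $I$-projective if it is a direct summand of $FP$ for a projective $H$-module $P$. A ring is Gorenstein if it is left and right noetherian with finite injective dimension as a left and right module over itself. An $H$-module $M$ is Gorenstein projective if $M=\ker(d_0)=\mathrm{im}(d_1)$ for an acyclic complex $(Y_\bullet,d_\bullet)$ of projectives which stays exact under $\mathrm{Hom}_H(\cdot,P)$ for all projective $P$. The Gorenstein projective model structure on $\mathrm{Mod}(H)$ has as cofibrations the monomorphisms with Gorenstein projective cokernel, as fibrations the epimorphisms, and as trivial objects the modules of finite projective dimension (its weak equivalences are the composites of a monomorphism with projective cokernel followed by an epimorphism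 with kernel of finite projective dimension). The $I$-Gorenstein projective model structure on $\mathrm{Rep}^\infty_k(G)$ is its right transfer: $f$ is a fibration (resp. weak equivalence) iff $Uf$ is one in $\mathrm{Mod}(H)$; cofibrations are the maps with the left lifting property with respect to all trivial fibrations. Two morphisms in a model category are homotopic if they are both left homotopic (via some cylinder object) and right homotopic (via some path object), as in Hovey's book; path objects are arbitrary factorizations of the diagonal into a weak equivalence followed by a fibration. *)

(* Defs.v *)
From HB Require Import structures.
From mathcomp Require Import all_boot all_order all_algebra finmap.
From mathcomp Require Import ring_quotient.
From mathcomp Require Import all_classical topology.

Set Implicit Arguments.
Unset Strict Implicit.
Unset Printing Implicit Defensive.

Import GRing.Theory.

Local Open Scope classical_set_scope.
Local Open Scope ring_scope.

Record submod (R : pzRingType) (V : lmodType R) := Submod {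
  submod_set :> V -> Prop ;
  submod0 : submod_set 0 ;
  submodD : forall u v, submod_set u -> submod_set v -> submod_set (u + v) ;
  submodZ : forall a u, submod_set u -> submod_set (a *: u) }.

Section Submodules.
Context (R : pzRingType) (V : lmodType R).
Implicit Types (S : submod V) (A : set V).

Definition submod_pred S : {pred V} := fun x => `[< S x >].

Lemma submod_predP S : submod_closed (submod_pred S).
Proof.
split=> [|a u v /asboolP Su /asboolP Sv]; apply/asboolP; first exact: submod0.
by apply: submodD => //; apply: submodZ.
Qed.
HB.instance Definition _ S :=
  GRing.isSubmodClosed.Build R V (submod_pred S) (submod_predP S).

Definition smod S : Type := {x : V | x \in submod_pred S}.
HB.instance Definition _ S := SubChoice.on (smod S).
HB.instance Definition _ S :=
  [SubChoice_isSubLmodule of smod S by <:].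

Lemma smodP S (x : smod S) : S (val x).
Proof. exact/asboolP/(valP x). Qed.

Definition in_smod S x (Sx : S x) : smod S :=
  exist (fun x => x \in submod_pred S) x (asboolT Sx).

Definition qmod S : Type := Quotient.quot (submod_pred S).
HB.instance Definition _ S := Choice.on (qmod S).
HB.instance Definition _ S := GRing.Zmodule.on (qmod S).
HB.instance Definition _ S :
  EqQuotient V (Quotient.equiv (submod_pred S)) (qmod S) := EqQuotient.on (qmod S).

Definition qproj S (x : V) : qmod S := \pi_(qmod S)%qT x.

Lemma qprojE S x y : qproj S x = qproj S y <-> S (x - y).
Proof.
split=> [/eqP|Sxy]; last apply/eqP; rewrite /qproj -Quotient.idealrBE.
  by move/asboolP.
exact/asboolP.
Qed.

Lemma qproj_surj S q : exists x, qproj S x = q.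
Proof. by exists (repr q); rewrite /qproj reprK. Qed.

Definition qscale S a (q : qmod S) : qmod S := qproj S (a *: repr q).

Lemma qprojD S : {morph qproj S : x y / x + y}.
Proof. by move=> x y; rewrite /qproj !piE. Qed.

Lemma qprojZ S a x : qscale a (qproj S x) = qproj S (a *: x).
Proof.
apply/qprojE; rewrite -scalerBr; apply/submodZ/qprojE.
by rewrite /qproj reprK.
Qed.

Fact qscaleA S a b (v : qmod S) : qscale a (qscale b v) = qscale (a * b) v.
Proof. by have [x <-] := qproj_surj v; rewrite !qprojZ scalerA. Qed.
Fact qscale1 S : left_id 1 (@qscale S).
Proof. by move=> v; have [x <-] := qproj_surj v; rewrite !qprojZ scale1r. Qed.
Fact qscaleDr S : right_distributive (@qscale S) +%R.
Proof.
move=> a u v; have [x <-] := qproj_surj u; have [y <-] := qproj_surj v.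
by rewrite !(qprojZ, =^~qprojD) scalerDr.
Qed.
Fact qscaleDl S (v : qmod S) : {morph (@qscale S)^~ v : a b / a + b}.
Proof.
by move=> a b; have [x <-] := qproj_surj v; rewrite !(qprojZ, =^~qprojD) scalerDl.
Qed.
HB.instance Definition _ S := GRing.Zmodule_isLmodule.Build R (qmod S)
  (@qscaleA S) (@qscale1 S) (@qscaleDr S) (@qscaleDl S).

Fact qproj_linear S : linear (qproj S).
Proof. by move=> a u v; rewrite qprojD -qprojZ. Qed.
HB.instance Definition _ S :=
  GRing.isLinear.Build R V (qmod S) _ (qproj S) (@qproj_linear S).

Definition submod_span_set A : V -> Prop :=
  fun x => forall S, A `<=` submod_set S -> S x.

Fact span0 A : submod_span_set A 0. Proof. by move=> S _; apply: submod0. Qed.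
Fact spanD A u v : submod_span_set A u -> submod_span_set A v -> submod_span_set A (u + v).
Proof. by move=> Au Av S AS; apply: submodD; [apply: Au|apply: Av]. Qed.
Fact spanZ A a u : submod_span_set A u -> submod_span_set A (a *: u).
Proof. by move=> Au S AS; apply/submodZ/Au. Qed.
Definition submod_span A : submod V := Submod (@span0 A) (@spanD A) (@spanZ A).
End Submodules.

Section Kernels.
Context (R : pzRingType) (U V : lmodType R) (f : {linear U -> V}).

Fact lin_kernel0 : f 0 = 0. Proof. exact: linear0. Qed.
Fact lin_kernelD u v : f u = 0 -> f v = 0 -> f (u + v) = 0.
Proof. by move=> fu fv; rewrite linearD fu fv addr0. Qed.
Fact lin_kernelZ a u : f u = 0 -> f (a *: u) = 0.
Proof. by move=> fu; rewrite linearZ_LR fu scaler0. Qed.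
Definition lin_kernel : submod U :=
  Submod (submod_set := fun u => f u = 0) lin_kernel0 lin_kernelD lin_kernelZ.

Fact lin_image0 : exists u, f u = 0. Proof. by exists 0; apply: linear0. Qed.
Fact lin_imageD v w : (exists u, f u = v) -> (exists u, f u = w) -> exists u, f u = v + w.
Proof. by move=> [x <-] [y <-]; exists (x + y); rewrite linearD. Qed.
Fact lin_imageZ a v : (exists u, f u = v) -> exists u, f u = a *: v.
Proof. by move=> [x <-]; exists (a *: x); rewrite linearZ_LR. Qed.
Definition lin_image : submod V :=
  Submod (submod_set := fun v => exists u, f u = v) lin_image0 lin_imageD lin_imageZ.

Definition cokernel := qmod lin_image.
End Kernels.

Definition onto (A B : Type) (f : A -> B) := forall y, exists x, f x = y.

Section Homological.
Context (R : pzRingType).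
Implicit Types M P : lmodType R.

Definition projective P := forall (M N : lmodType R) (e : {linear M -> N})
    (f : {linear P -> N}), onto e ->
  exists h : {linear P -> M}, e \o h =1 f.

Definition injective_module P := forall (M N : lmodType R) (m : {linear M -> N})
    (f : {linear M -> P}), injective m ->
  exists h : {linear N -> P}, h \o m =1 f.

(** A finite injective resolution [0 -> M -> J 0 -> ... -> J n -> 0], extended
    by zero modules. *)
Definition finite_injective_dimension M :=
  exists (J : nat -> lmodType R) (e : {linear M -> J 0%N})
      (d : forall i, {linear J i -> J i.+1}) (n : nat),
  [/\ forall i, injective_module (J i),
      injective e,
      lin_kernel (d 0%N) = lin_image e :> set _,
      forall i, lin_kernel (d i.+1) = lin_image (d i) :> set _
    & forall i, (n < i)%N -> forall x : J i, x = 0].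

Definition finite_projective_dimension M :=
  exists (P : nat -> lmodType R) (e : {linear P 0%N -> M})
      (d : forall i, {linear P i.+1 -> P i}) (n : nat),
  [/\ forall i, projective (P i),
      onto e,
      lin_kernel e = lin_image (d 0%N) :> set _,
      forall i, lin_kernel (d i) = lin_image (d i.+1) :> set _
    & forall i, (n < i)%N -> forall x : P i, x = 0].

(** The differential [d i : Y (i + 1) -> Y i] is the one usually written
    [d_(i+1)], so that [lin_image (d 0)] is [im(d_1) = ker(d_0)]. *)
Definition gorenstein_projective M :=
  exists (Y : int -> lmodType R) (d : forall i : int, {linear Y (i + 1) -> Y i}),
  [/\ forall i, projective (Y i),
      forall i, lin_kernel (d i) = lin_image (d (i + 1)) :> set _,
      forall (P : lmodType R), projective P ->
        forall i (f : {linear Y (i + 1) -> P}), f \o d (i + 1) =1 (fun=> 0) ->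
        exists h : {linear Y i -> P}, h \o d i =1 f
    & exists e : {linear M -> Y 0}, injective e /\ lin_image e = lin_image (d 0) :> set _].
End Homological.

Definition left_noetherian (R : pzRingType) :=
  forall J : nat -> submod R^o, (forall n, submod_set (J n) `<=` submod_set (J n.+1)) ->
  exists n, forall m, (n <= m)%N -> submod_set (J m) = submod_set (J n).

(** Right modules over [R] are left modules over the converse ring [R^c]. *)
Definition gorenstein_ring (R : pzRingType) :=
  [/\ left_noetherian R, left_noetherian R^c,
      finite_injective_dimension R^o
    & finite_injective_dimension (R^c)^o].

Record category := Category {
  obj :> Type ;
  hom : obj -> obj -> Type ;
  idm : forall A, hom A A ;
  compm : forall A B C, hom B C -> hom A B -> hom A C ;
  compm1 : forall A B (f : hom A B), compm f (idm A) = f ;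
  comp1m : forall A B (f : hom A B), compm (idm B) f = f ;
  compmA : forall A B C D (h : hom C D) (g : hom B C) (f : hom A B),
    compm h (compm g f) = compm (compm h g) f }.
Arguments hom {c} A B.
Arguments idm {c} A.
Arguments compm {c A B C} g f.

(** Only the three classes of maps; the model category axioms are not imposed. *)
Record model_classes (C : category) := ModelClasses {
  cof : forall A B : C, hom A B -> Prop ;
  fib : forall A B : C, hom A B -> Prop ;
  weq : forall A B : C, hom A B -> Prop }.
Arguments cof {C} m {A B} f.
Arguments fib {C} m {A B} f.
Arguments weq {C} m {A B} f.

Section ModelCategories.
Context (C : category).

Definition left_lifting (A B X Y : C) (i : hom A B) (p : hom X Y) :=
  forall (u : hom A X) (v : hom B Y), compm p u = compm v i ->
  exists h : hom B X, compm h i = u /\ compm p h = v.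

Definition is_initial (Z : C) := forall B : C, exists! m : hom Z B, True.

Definition is_coproduct (A B S : C) (j0 : hom A S) (j1 : hom B S) :=
  forall (X : C) (u : hom A X) (v : hom B X),
  exists! h : hom S X, compm h j0 = u /\ compm h j1 = v.

Definition is_product (A B T : C) (q0 : hom T A) (q1 : hom T B) :=
  forall (X : C) (u : hom X A) (v : hom X B),
  exists! h : hom X T, compm q0 h = u /\ compm q1 h = v.

Context (m : model_classes C).

Definition cofibrant (B : C) :=
  exists (Z : C) (z : hom Z B), is_initial Z /\ cof m z.

(** [A + A -> Cyl -> A] factors the fold map into a cofibration followed by a
    weak equivalence. *)
Definition is_cylinder (A Cyl : C) (i0 i1 : hom A Cyl) (s : hom Cyl A) :=
  exists (S : C) (j0 j1 : hom A S) (i : hom S Cyl),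
  [/\ is_coproduct j0 j1, cof m i /\ weq m s,
      compm i j0 = i0 /\ compm i j1 = i1
    & compm s i0 = idm A /\ compm s i1 = idm A].

(** [B -> Pth -> B * B] factors the diagonal into a weak equivalence followed
    by a fibration. *)
Definition is_path_object (B Pth : C) (r : hom B Pth) (p0 p1 : hom Pth B) :=
  exists (T : C) (q0 q1 : hom T B) (p : hom Pth T),
  [/\ is_product q0 q1, weq m r /\ fib m p,
      compm q0 p = p0 /\ compm q1 p = p1
    & compm p0 r = idm B /\ compm p1 r = idm B].

Definition left_homotopic (A B : C) (f g : hom A B) :=
  exists (Cyl : C) (i0 i1 : hom A Cyl) (s : hom Cyl A) (K : hom Cyl B),
  [/\ is_cylinder i0 i1 s, compm K i0 = f & compm K i1 = g].

Definition right_homotopic (A B : C) (f g : hom A B) :=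
  exists (Pth : C) (r : hom B Pth) (p0 p1 : hom Pth B) (K : hom A Pth),
  [/\ is_path_object r p0 p1, compm p0 K = f & compm p1 K = g].

Definition homotopic (A B : C) (f g : hom A B) :=
  left_homotopic f g /\ right_homotopic f g.
End ModelCategories.

Lemma linear_ext (R : pzRingType) (U V : lmodType R) (f g : {linear U -> V}) :
  f =1 g -> f = g.
Proof.
move/funext; case: f => f [[fD] [fZ]]; case: g => g [[gD] [gZ]] /= fg.
by subst g; rewrite (Prop_irrelevance fD gD) (Prop_irrelevance fZ gZ).
Qed.

Section ModuleCategory.
Context (R : pzRingType).

Definition lin_id (M : lmodType R) : {linear M -> M} := idfun.
Definition lin_comp (L M N : lmodType R) (g : {linear M -> N})
  (f : {linear L -> M}) : {linear L -> N} := g \o f.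

Fact lin_comp1 (M N : lmodType R) (f : {linear M -> N}) : lin_comp f (lin_id M) = f.
Proof. exact: linear_ext. Qed.
Fact lin_1comp (M N : lmodType R) (f : {linear M -> N}) : lin_comp (lin_id N) f = f.
Proof. exact: linear_ext. Qed.
Fact lin_compA (L M N P : lmodType R) (h : {linear N -> P}) (g : {linear M -> N})
    (f : {linear L -> M}) :
  lin_comp h (lin_comp g f) = lin_comp (lin_comp h g) f.
Proof. exact: linear_ext. Qed.

Definition Mod : category := Category lin_comp1 lin_1comp lin_compA.

Definition gproj_cof (M N : Mod) (f : hom M N) :=
  injective (f : {linear _ -> _}) /\ gorenstein_projective (cokernel f).

Definition gproj_fib (M N : Mod) (f : hom M N) := onto (f : {linear _ -> _}).

Definition gproj_weq (M N : Mod) (f : hom M N) :=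
  exists (E : Mod) (i : hom M E) (q : hom E N),
  [/\ f = compm q i,
      injective (i : {linear _ -> _}) /\ projective (cokernel i)
    & onto (q : {linear _ -> _}) /\
      finite_projective_dimension (smod (lin_kernel q))].

Definition gproj_model : model_classes Mod :=
  ModelClasses gproj_cof gproj_fib gproj_weq.
End ModuleCategory.

HB.mixin Record isTopologicalGroup G of Group G & Topological G := {
  mulg_continuous : continuous (fun x : G * G => (x.1 * x.2)%g) ;
  invg_continuous : continuous (fun x : G => (x^-1)%g) }.

#[short(type="topologicalGroupType")]
HB.structure Definition TopologicalGroup :=
  {G of Group G & Topological G & isTopologicalGroup G}.

Definition is_subgroup (G : groupType) (I : set G) :=
  [/\ I 1%g, forall x y, I x -> I y -> I (x * y)%g & forall x, I x -> I (x^-1)%g].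

Definition left_coset (G : groupType) (x : G) (I : set G) : set G :=
  [set (x * y)%g | y in I].

(** A pro-[p] group is a compact, Hausdorff, totally disconnected group all of
    whose open normal subgroups have [p]-power index; here this is imposed on
    an open subgroup [I] of [G] with its subspace topology. *)
Definition pro_p (p : nat) (G : topologicalGroupType) (I : set G) :=
  [/\ compact I, hausdorff_space I, totally_disconnected I
    & forall N : set G, open N -> is_subgroup N -> N `<=` I ->
        (forall x y, I x -> N y -> N (x * y * x^-1)%g) ->
        exists n : nat, ([set left_coset x N | x in I] #= `I_(p ^ n))%card].

Record open_pro_p_subgroup (p : nat) (G : topologicalGroupType) := OpenProP {
  opengrp_set :> set G ;
  opengrp_open : open opengrp_set ;
  opengrp_group : is_subgroup opengrp_set ;
  opengrp_pro_p : pro_p p opengrp_set }.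

Record smooth_rep (k : fieldType) (G : topologicalGroupType) := SmoothRep {
  rep_mod :> lmodType k ;
  act : G -> {linear rep_mod -> rep_mod} ;
  act1 : forall v, act 1%g v = v ;
  actM : forall g h v, act (g * h)%g v = act g (act h v) ;
  act_smooth : forall v, open [set g | act g v = v] }.
Arguments act {k G s} _.

Record rep_hom (k : fieldType) (G : topologicalGroupType)
    (V W : smooth_rep k G) := RepHom {
  rep_fun :> {linear V -> W} ;
  rep_equiv : forall g v, rep_fun (act g v) = act g (rep_fun v) }.

Section Representations.
Context (k : fieldType) (G : topologicalGroupType).
Implicit Types U V W : smooth_rep k G.

Lemma actK V g (v : V) : act g^-1%g (act g v) = v.
Proof. by rewrite -actM mulVg act1. Qed.
Lemma actVK V g (v : V) : act g (act g^-1%g v) = v.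
Proof. by rewrite -actM mulgV act1. Qed.

Lemma rep_ext V W (f g : rep_hom V W) : f =1 g -> f = g.
Proof.
case: f => f fP; case: g => g gP /= /linear_ext fg; subst g.
by rewrite (Prop_irrelevance fP gP).
Qed.

Definition rep_id V : rep_hom V V := @RepHom k G V V idfun (fun _ _ => erefl).

Fact rep_comp_equiv U V W (g : rep_hom V W) (f : rep_hom U V) x (v : U) :
  (g \o f) (act x v) = act x ((g \o f) v).
Proof. by rewrite /= !rep_equiv. Qed.
Definition rep_comp U V W (g : rep_hom V W) (f : rep_hom U V) : rep_hom U W :=
  @RepHom k G U W (g \o f) (rep_comp_equiv g f).

Fact rep_comp1 V W (f : rep_hom V W) : rep_comp f (rep_id V) = f.
Proof. exact: rep_ext. Qed.
Fact rep_1comp V W (f : rep_hom V W) : rep_comp (rep_id W) f = f.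
Proof. exact: rep_ext. Qed.
Fact rep_compA U V W Z (h : rep_hom W Z) (g : rep_hom V W) (f : rep_hom U V) :
  rep_comp h (rep_comp g f) = rep_comp (rep_comp h g) f.
Proof. exact: rep_ext. Qed.

Definition Rep : category := Category rep_comp1 rep_1comp rep_compA.

HB.instance Definition _ V W := gen_eqMixin (rep_hom V W).
HB.instance Definition _ V W := gen_choiceMixin (rep_hom V W).

Section HomGroup.
Context (V W : smooth_rep k G).
Implicit Types f g : rep_hom V W.

Fact rep_zero_equiv x (v : V) : GRing.null_fun W (act x v) = act x (GRing.null_fun W v).
Proof. by rewrite linear0. Qed.
Definition rep_zero : rep_hom V W := @RepHom k G V W (GRing.null_fun W) rep_zero_equiv.

Fact rep_opp_equiv f x (v : V) : (\- f) (act x v) = act x ((\- f) v).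
Proof. by rewrite /= rep_equiv linearN. Qed.
Definition rep_opp f : rep_hom V W := @RepHom k G V W (\- f) (rep_opp_equiv f).

Fact rep_add_equiv f g x (v : V) : (f \+ g) (act x v) = act x ((f \+ g) v).
Proof. by rewrite /= !rep_equiv linearD. Qed.
Definition rep_add f g : rep_hom V W := @RepHom k G V W (f \+ g) (rep_add_equiv f g).

Fact rep_addA : associative rep_add.
Proof. by move=> f g h; apply: rep_ext => v /=; rewrite addrA. Qed.
Fact rep_addC : commutative rep_add.
Proof. by move=> f g; apply: rep_ext => v /=; rewrite addrC. Qed.
Fact rep_add0 : left_id rep_zero rep_add.
Proof. by move=> f; apply: rep_ext => v /=; rewrite add0r. Qed.
Fact rep_addN : left_inverse rep_zero rep_opp rep_add.
Proof. by move=> f; apply: rep_ext => v /=; rewrite addNr. Qed.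
HB.instance Definition _ :=
  GRing.isZmodule.Build (rep_hom V W) rep_addA rep_addC rep_add0 rep_addN.
End HomGroup.

(** The endomorphism ring [End_G(V)], whose product is composition. *)
Definition rep_end V : Type := rep_hom V V.
HB.instance Definition _ V := GRing.Zmodule.on (rep_end V).

Section EndRing.
Context (V : smooth_rep k G).
Implicit Types f g h : rep_end V.

Definition end_one : rep_end V := rep_id V.
Definition end_mul f g : rep_end V := rep_comp f g.

Fact end_mulA : associative end_mul.
Proof. by move=> f g h; apply: rep_ext. Qed.
Fact end_mul1 : left_id end_one end_mul.
Proof. by move=> f; apply: rep_ext. Qed.
Fact end_1mul : right_id end_one end_mul.
Proof. by move=> f; apply: rep_ext. Qed.
Fact end_mulDl : left_distributive end_mul +%R.
Proof. by move=> f g h; apply: rep_ext. Qed.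
Fact end_mulDr : right_distributive end_mul +%R.
Proof. by move=> f g h; apply: rep_ext => v /=; rewrite linearD. Qed.
HB.instance Definition _ := GRing.Zmodule_isPzRing.Build (rep_end V)
  end_mulA end_mul1 end_1mul end_mulDl end_mulDr.
End EndRing.
End Representations.

Section GroupTopology.
Context (G : topologicalGroupType).

Lemma continuous_mull (x : G) : continuous (fun y => x * y)%g.
Proof.
move=> y; apply: (@continuous_comp _ _ _ (fun y => (x, y)) (fun z => z.1 * z.2)%g).
  by apply: cvg_pair; [exact: cvg_cst|exact: cvg_id].
exact: mulg_continuous.
Qed.

Lemma continuous_mulr (x : G) : continuous (fun y => y * x)%g.
Proof.
move=> y; apply: (@continuous_comp _ _ _ (fun y => (y, x)) (fun z => z.1 * z.2)%g).
  by apply: cvg_pair; [exact: cvg_id|exact: cvg_cst].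
exact: mulg_continuous.
Qed.

Lemma open_stabilizer (T : Type) (a : G -> T -> T) (t : T) :
  (forall t, a 1%g t = t) -> (forall g h t, a (g * h)%g t = a g (a h t)) ->
  nbhs (1%g : G) [set g | a g t = t] -> open [set g | a g t = t].
Proof.
move=> a1 aM st; rewrite openE => g /= gt.
have : (g^-1 * h)%g @[h --> g] --> (g^-1 * g)%g by exact: continuous_mull.
rewrite mulVg => /(_ _ st) gst.
rewrite /interior /=; near=> h.
have /= ght : [set g | a g t = t] (g^-1 * h)%g by near: h.
by rewrite -(mulVKg g h) aM ght.
Unshelve. all: by end_near. Qed.

(* [compact_cover] is stated for pointed spaces. *)
Lemma compact_group_cover (A : set G) : compact A -> cover_compact A.
Proof.
pose Gp : ptopologicalType := HB.pack (TopologicalGroup.sort G)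
  (isPointed.Build (TopologicalGroup.sort G) (1%g : G)).
by have -> : @compact G = @cover_compact Gp by exact: (@compact_cover Gp).
Qed.
End GroupTopology.

Section Induction.
Context (k : fieldType) (p : nat) (G : topologicalGroupType).
Context (I : open_pro_p_subgroup p G).

Lemma opengrp1 : (I : set G) 1%g. Proof. by have [] := opengrp_group I. Qed.
Lemma opengrpM x y : (I : set G) x -> (I : set G) y -> (I : set G) (x * y)%g.
Proof. by have [_ + _] := opengrp_group I; exact. Qed.
Lemma opengrpV x : (I : set G) x -> (I : set G) (x^-1)%g.
Proof. by have [_ _] := opengrp_group I; exact. Qed.

Lemma mem_left_coset x y : left_coset x I y <-> (I : set G) (x^-1 * y)%g.
Proof.
split=> [[z Iz <-]|Ixy]; first by rewrite mulKg.
by exists (x^-1 * y)%g; rewrite ?mulVKg.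
Qed.

Lemma left_coset_eq x y : left_coset x I y -> left_coset y I = left_coset x I.
Proof.
move/mem_left_coset => Ixy; apply/seteqP; split=> z /mem_left_coset Iz;
  apply/mem_left_coset.
  by rewrite -(mulVKg y z) mulgA; apply: opengrpM.
have -> : (y^-1 * z = (x^-1 * y)^-1 * (x^-1 * z))%g.
  by rewrite invgM invgK -!mulgA mulVKg.
by apply: opengrpM => //; apply: opengrpV.
Qed.

Lemma left_coset_id x : left_coset x I x.
Proof. by apply/mem_left_coset; rewrite mulVg; apply: opengrp1. Qed.

Lemma open_left_coset x : open (left_coset x I).
Proof.
have -> : left_coset x I = (fun y => x^-1 * y)%g @^-1` I.
  by apply/seteqP; split=> y /mem_left_coset.
apply: open_comp; last exact: opengrp_open.
by move=> y _; apply: continuous_mull.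
Qed.

Lemma closure_opengrp : closure I `<=` I.
Proof.
move=> x /(_ (left_coset x I)) [|y [Iy /mem_left_coset Ixy]].
  apply: open_nbhs_nbhs; split; [exact: open_left_coset|exact: left_coset_id].
have -> : x = (y * (x^-1 * y)^-1)%g by rewrite invgM invgK mulVKg.
by apply: opengrpM => //; apply: opengrpV.
Qed.

(** The functions [f : G -> k] with compact support and [f (g i) = f g]. *)
Definition ind_set (f : G -> k^o) : Prop :=
  compact (closure [set g | f g != 0]) /\ forall g i, (I : set G) i -> f (g * i)%g = f g.

Lemma compact_supportS (f : G -> k^o) (A : set G) :
  compact A -> closed A -> [set g | f g != 0] `<=` A ->
  compact (closure [set g | f g != 0]).
Proof.
move=> cA clA fA; apply: (subclosed_compact _ cA); first exact: closed_closure.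
by rewrite (closure_id A).1 //; apply: closureS.
Qed.

Fact ind0 : ind_set 0.
Proof.
split=> //; apply: (@compact_supportS _ set0).
- exact: compact0.
- exact: closed0.
- by move=> g /=; rewrite eqxx.
Qed.

Fact indD f g : ind_set f -> ind_set g -> ind_set (f + g).
Proof.
move=> [cf fI] [cg gI]; split; last first.
  by move=> x i Ii; rewrite /GRing.add /= fI // gI.
apply: compact_supportS (compactU cf cg) _ _.
  by apply: closedU; apply: closed_closure.
move=> x /= fgx; have [fx|fx] := eqVneq (f x) 0; last by left; apply: subset_closure.
right; apply: subset_closure => /=; apply: contraNneq fgx => gx.
by rewrite /GRing.add /= fx gx addr0.
Qed.

Fact indZ a f : ind_set f -> ind_set (a *: f).
Proof.
move=> [cf fI]; split; last by move=> x i Ii; rewrite /GRing.scale /= fI.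
apply: compact_supportS cf _ _; first exact: closed_closure.
move=> x /= fx; apply: subset_closure => /=; apply: contraNneq fx => fx.
by rewrite /GRing.scale /= fx scaler0.
Qed.

Definition ind_submod : submod (G -> k^o) := Submod ind0 indD indZ.
Definition ind : Type := smod ind_submod.
HB.instance Definition _ := GRing.Lmodule.on ind.

Definition ind_fun (f : ind) : G -> k^o := val f.

Lemma ind_ext (f f' : ind) : ind_fun f =1 ind_fun f' -> f = f'.
Proof. by move=> ff; apply/val_inj/funext. Qed.

Fact ind_fun_linear : linear ind_fun. Proof. by []. Qed.
HB.instance Definition _ :=
  GRing.isLinear.Build k ind (G -> k^o) _ ind_fun ind_fun_linear.

Lemma ind_funP a (f f' : ind) x :
  ind_fun (a *: f + f') x = a * ind_fun f x + ind_fun f' x.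
Proof. by []. Qed.

Lemma ind_inv (f : ind) g i : (I : set G) i -> ind_fun f (g * i)%g = ind_fun f g.
Proof. by have [_] := smodP f; exact. Qed.

Fact ind_act_subproof g (f : ind) : ind_set (fun x => ind_fun f (g^-1 * x)%g).
Proof.
split; last by move=> x i Ii; rewrite mulgA ind_inv.
have [cf _] := smodP f; rewrite -/(ind_fun f) in cf.
apply: (@compact_supportS _ ((fun x => g^-1 * x)%g @^-1` closure [set x | ind_fun f x != 0])).
- have -> : (fun x => g^-1 * x)%g @^-1` closure [set x | ind_fun f x != 0] =
    (fun x => g * x)%g @` closure [set x | ind_fun f x != 0].
    apply/seteqP; split=> [x /= fx|_ [x fx <-] /=].
      by exists (g^-1 * x)%g; rewrite ?mulVKg.
    by rewrite mulKg.
  apply: continuous_compact => //; apply: continuous_subspaceT.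
  exact: continuous_mull.
- apply: closed_comp; last exact: closed_closure.
  by move=> x _; apply: continuous_mull.
- by move=> x /= fx; apply: subset_closure.
Qed.

Definition ind_act g (f : ind) : ind := in_smod (S := ind_submod) (ind_act_subproof g f).

Lemma ind_actE g f x : ind_fun (ind_act g f) x = ind_fun f (g^-1 * x)%g.
Proof. by []. Qed.

Fact ind_act_linear g : linear (ind_act g).
Proof. by move=> a u v; apply: ind_ext => x. Qed.
HB.instance Definition _ g :=
  GRing.isLinear.Build k ind ind _ (ind_act g) (ind_act_linear g).

Fact ind_act1 f : ind_act 1%g f = f.
Proof. by apply: ind_ext => x; rewrite ind_actE invg1 mul1g. Qed.
Fact ind_actM g h f : ind_act (g * h)%g f = ind_act g (ind_act h f).
Proof. by apply: ind_ext => x; rewrite !ind_actE invgM mulgA. Qed.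

(** A set of representatives of the left cosets [g I]. *)
Definition crep (g : G) : G := xget 1%g (left_coset g I).
Definition creps : set G := range crep.

Lemma crep_mem g : left_coset g I (crep g).
Proof. by apply: xgetPex; exists g; apply: left_coset_id. Qed.

Lemma crep_eq g h : left_coset g I h -> crep h = crep g.
Proof. by rewrite /crep => /left_coset_eq ->. Qed.

Lemma crepK g : creps g -> crep g = g.
Proof. by move=> [h _ <-]; apply/crep_eq/crep_mem. Qed.

Lemma crep_inv (T : Type) (F : G -> T) g :
  (forall g i, (I : set G) i -> F (g * i)%g = F g) -> F (crep g) = F g.
Proof. by move=> FI; have [i Ii <-] := crep_mem g; rewrite FI. Qed.

Lemma ind_finite f : finite_set (creps `&` [set g | ind_fun f g != 0]).
Proof.
have [+ _] := smodP f; rewrite -/(ind_fun f).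
move=> /compact_group_cover /(_ G setT (fun x => left_coset x I)) [].
- by move=> x _; apply: open_left_coset.
- by move=> x _; exists x => //; apply: left_coset_id.
move=> D _ fD.
apply: (@sub_finite_set _ _ (crep @` [set` D])); last first.
  exact/finite_image/finite_fset.
move=> x [/crepK xK /= fx]; have [d Dd dx] := fD x (@subset_closure _ [set g | ind_fun f g != 0] x fx).
by exists d => //; rewrite -xK (crep_eq dx).
Qed.

Fact ind_smooth f : open [set g | ind_act g f = f].
Proof.
apply: open_stabilizer; [exact: ind_act1|exact: ind_actM|].
have /finite_fsetP[D DE] := ind_finite f.
have : nbhs (1%g : G) (\bigcap_(x in [set` D]) [set g | (I : set G) (x^-1 * (g^-1 * x))%g]).
  apply: filter_bigI => x _; apply: open_nbhs_nbhs; split.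
    apply: (@open_comp _ _ (fun g => x^-1 * (g^-1 * x))%g).
      move=> g _; apply: (@continuous_comp _ _ _ (fun g => g^-1)%g (fun g => x^-1 * (g * x))%g).
        exact: invg_continuous.
      apply: (@continuous_comp _ _ _ (fun g => g * x)%g (fun g => x^-1 * g)%g).
        exact: continuous_mulr.
      exact: continuous_mull.
    exact: opengrp_open.
  by rewrite /= invg1 mul1g mulVg; apply: opengrp1.
apply: filterS => g gI; apply: ind_ext => y; rewrite ind_actE.
have key z : ind_fun f z != 0 -> ind_fun f (g^-1 * z)%g = ind_fun f z /\
    ind_fun f (g * z)%g = ind_fun f z.
  move=> fz; have [i Ii zE] := crep_mem z.
  have Ig : (I : set G) ((crep z)^-1 * (g^-1 * crep z))%g.
    apply: gI; rewrite /= -[is_true _]/([set` D] (crep z)) -DE; split.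
      by exists z.
    by rewrite /= (crep_inv _ (@ind_inv f)).
  have zi : z = (crep z * i^-1)%g by rewrite -zE mulgK.
  have Iig : (I : set G) (i^-1)%g by apply: opengrpV.
  split.
    rewrite {1}zi -[RHS](crep_inv _ (@ind_inv f)).
    rewrite mulgA ind_inv // -(mulVKg (crep z) (g^-1 * crep z)%g).
    by rewrite ind_inv.
  rewrite {1}zi -[RHS](crep_inv _ (@ind_inv f)).
  rewrite mulgA ind_inv // -(mulVKg (crep z) (g * crep z)%g) ind_inv //.
  suff -> : ((crep z)^-1 * (g * crep z) = ((crep z)^-1 * (g^-1 * crep z))^-1)%g.
    exact: opengrpV.
  by rewrite !invgM !invgK mulgA.
have [fy|/key[]//] := eqVneq (ind_fun f y) 0.
have [fgy|/key[_]] := eqVneq (ind_fun f (g^-1 * y)%g) 0; first by rewrite fgy.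
by rewrite mulVKg.
Qed.

(** The representation [X = ind_I^G(k)]. *)
Definition ind_rep : smooth_rep k G :=
  @SmoothRep k G ind ind_act ind_act1 ind_actM ind_smooth.

(** [H = End_G(X)^op]. *)
Definition hecke : pzRingType := (rep_end ind_rep)^c.
End Induction.

Section Frobenius.
Context (k : fieldType) (p : nat) (G : topologicalGroupType).
Context (I : open_pro_p_subgroup p G).

Notation X := (ind_rep k I).

Fact indicator_subproof : ind_set I (fun g => if `[< (I : set G) g >] then 1 else 0 : k^o).
Proof.
split; last first.
  move=> g i Ii; congr (if _ then _ else _); apply: asbool_equiv_eq; split=> Ig.
    by rewrite -(mulgK i g); apply: opengrpM => //; apply: opengrpV.
  exact: opengrpM.
have [cI _ _ _] := opengrp_pro_p I.
apply: (compact_supportS cI).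
  by rewrite closure_id; apply/seteqP; split;
    [exact: subset_closure|exact: closure_opengrp].
by move=> g /=; case: asboolP => //; rewrite eqxx.
Qed.

(** The characteristic function of [I], which generates [X]. *)
Definition indicator : X := in_smod (S := ind_submod k I) indicator_subproof.

Lemma indicatorE g : ind_fun indicator g = if `[< (I : set G) g >] then 1 else 0.
Proof. by []. Qed.

Lemma indicator_fixed i : (I : set G) i -> act i indicator = indicator.
Proof.
move=> Ii; apply: ind_ext => g; rewrite ind_actE !indicatorE.
congr (if _ then _ else _); apply: asbool_equiv_eq; split=> Ig.
  by rewrite -(mulVKg i g); apply: opengrpM.
by apply: opengrpM => //; apply: opengrpV.
Qed.

Lemma act_indicatorE x g :
  ind_fun (act x indicator) g = if `[< left_coset x I g >] then 1 else 0.
Proof.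
rewrite ind_actE indicatorE; congr (if _ then _ else _).
by apply: asbool_equiv_eq; split => /mem_left_coset.
Qed.

Section InvariantVectors.
Context (V : smooth_rep k G).

Fact inv0 : forall i, (I : set G) i -> act i (0 : V) = 0.
Proof. by move=> i _; rewrite linear0. Qed.
Fact invD (v w : V) : (forall i, (I : set G) i -> act i v = v) ->
  (forall i, (I : set G) i -> act i w = w) ->
  forall i, (I : set G) i -> act i (v + w) = v + w.
Proof. by move=> vI wI i Ii; rewrite linearD vI // wI. Qed.
Fact invZ a (v : V) : (forall i, (I : set G) i -> act i v = v) ->
  forall i, (I : set G) i -> act i (a *: v) = a *: v.
Proof. by move=> vI i Ii; rewrite linearZ_LR vI. Qed.

Definition inv_submod : submod V :=
  Submod (submod_set := fun v => forall i, (I : set G) i -> act i v = v) inv0 invD invZ.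

(** [V^I]; its [k]-structure is the restriction of its [H]-structure, and only
    the latter is declared below. *)
Definition invariants : Type := smod inv_submod.
HB.instance Definition _ := GRing.Zmodule.on invariants.

Definition inv_val (v : invariants) : V := val v.

Lemma inv_valP (v : invariants) i : (I : set G) i -> act i (inv_val v) = inv_val v.
Proof. exact: (smodP v). Qed.

Lemma inv_ext (v w : invariants) : inv_val v = inv_val w -> v = w.
Proof. exact: val_inj. Qed.

(** Frobenius reciprocity [V^I = Hom_G(X, V)]: the invariant vector [v]
    corresponds to [f |-> \sum_(x in G/I) f(x) x v]. *)
Definition frob_fun (v : invariants) (f : X) : V :=
  \sum_(x \in creps I) ind_fun f x *: act x (inv_val v).

Lemma frob_funE v f (A : set G) : finite_set A -> A `<=` creps I ->
    (forall x, creps I x -> ind_fun f x != 0 -> A x) ->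
  frob_fun v f = \sum_(x \in A) ind_fun f x *: act x (inv_val v).
Proof.
move=> finA AI fA; apply/esym/fsbig_widen => // x [Ix nAx] /=.
have [->|fx] := eqVneq (ind_fun f x) 0; first by rewrite scale0r.
by have /nAx := fA x Ix fx.
Qed.

Fact frob_linear v : linear (frob_fun v).
Proof.
move=> a f g.
pose A := (creps I `&` [set x | ind_fun f x != 0]) `|`
          (creps I `&` [set x | ind_fun g x != 0]).
have finA : finite_set A by rewrite finite_setU; split; apply: ind_finite.
have AI : A `<=` creps I by move=> x [[]|[]].
rewrite !(@frob_funE _ _ A) //; last 3 first.
- by move=> x Ix gx; right.
- by move=> x Ix fx; left.
- move=> x Ix; have [fx|fx _] := eqVneq (ind_fun f x) 0; last by left.
  have [gx|gx _] := eqVneq (ind_fun g x) 0; last by right.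
  by rewrite ind_funP fx gx mulr0 addr0 eqxx.
rewrite !fsbig_finite // scaler_sumr -big_split /=.
by apply: eq_bigr => x _; rewrite scalerA -scalerDl ind_funP.
Qed.
HB.instance Definition _ v :=
  GRing.isLinear.Build k X V _ (frob_fun v) (frob_linear v).

Lemma act_crep v x : act (crep I x) (inv_val v) = act x (inv_val v).
Proof.
apply: (crep_inv (F := fun x => act x (inv_val v))) => g i Ii.
by rewrite actM inv_valP.
Qed.

Fact frob_equiv v g f : frob_fun v (act g f) = act g (frob_fun v f).
Proof.
rewrite /frob_fun.
have bij : set_bij (creps I) (creps I) (fun x => crep I (g * x)%g).
  split.
  - by move=> x _; exists (g * x)%g.
  - move=> x y; rewrite !inE => /crepK xK /crepK yK.
    move=> /(congr1 (fun z => crep I (g^-1 * z)%g)).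
    have gK z : crep I (g^-1 * crep I (g * z))%g = crep I z.
      apply: crep_eq; have [i Ii <-] := crep_mem I (g * z)%g.
      by rewrite -mulgA mulKg; exists i.
    by rewrite !gK xK yK.
  - move=> y Iy; exists (crep I (g^-1 * y)%g); first by exists (g^-1 * y)%g.
    rewrite -[RHS](crepK Iy); apply: crep_eq.
    have [i Ii <-] := crep_mem I (g^-1 * y)%g.
    by rewrite -mulgA mulVKg; exists i.
rewrite (reindex_fsbig _ _ _ _ bij) /=.
under eq_fsbigr => x _.
  rewrite act_crep (crep_inv _ (@ind_inv _ _ _ _ _)) ind_actE mulKg actM -linearZ_LR.
  over.
have /= finA := ind_finite f; set A := _ `&` _ in finA.
have AI : A `<=` creps I by move=> x [].
rewrite -!(fsbig_widen A (creps I)) //.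
- by rewrite !fsbig_finite // linear_sum.
- move=> x [Ix nAx] /=; have [->|fx] := eqVneq (ind_fun f x) 0.
    by rewrite scale0r.
  by case: nAx.
- move=> x [Ix nAx] /=; have [->|fx] := eqVneq (ind_fun f x) 0.
    by rewrite scale0r linear0.
  by case: nAx.
Qed.

Definition frob (v : invariants) : rep_hom X V :=
  @RepHom k G X V (frob_fun v) (frob_equiv v).

Lemma frob_indicator v : frob v indicator = inv_val v.
Proof.
have cI : creps I (crep I 1%g) by exists 1%g.
rewrite /= (@frob_funE v indicator [set crep I 1%g]) //.
- rewrite fsbig_set1 act_crep act1 (crep_inv _ (@ind_inv _ _ _ _ _)) indicatorE.
  by rewrite asboolT ?scale1r //; apply: opengrp1.
- by move=> x ->.
- move=> x /crepK xK; rewrite indicatorE; case: asboolP => [Ix _|]; last by rewrite eqxx.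
  by rewrite /= -xK; apply: crep_eq; exists x => //; rewrite mul1g.
Qed.
End InvariantVectors.

Lemma ind_expand (f : X) :
  f = \sum_(x <- fset_set (creps I `&` [set g | ind_fun f g != 0]))
        ind_fun f x *: act x indicator.
Proof.
apply: ind_ext => g; have finA := ind_finite f; set A := _ `&` _ in finA *.
have -> : ind_fun (\sum_(x <- fset_set A) ind_fun f x *: act x indicator) g =
    \sum_(x <- fset_set A) ind_fun f x * (if `[< left_coset x I g >] then 1 else 0).
  rewrite linear_sum /= fct_sumE; apply: eq_bigr => x _.
  by rewrite -act_indicatorE linearZ_LR.
have cg x : creps I x -> left_coset x I g -> x = crep I g.
  by move=> /crepK xK xg; rewrite (crep_eq xg) xK.
have [fg|fg] := eqVneq (ind_fun f g) 0.
  rewrite fg big1_seq // => x /andP[_]; rewrite in_fset_set // inE => -[Ix fx].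
  case: asboolP => [xg|_]; last by rewrite mulr0.
  by move: fx; rewrite /= (cg _ Ix xg) (crep_inv _ (@ind_inv _ _ _ _ _)) fg eqxx.
rewrite (big_fsetD1 (crep I g)) /=; last first.
  rewrite in_fset_set // inE; split; first by exists g.
  by rewrite /= (crep_inv _ (@ind_inv _ _ _ _ _)).
rewrite asboolT; last first.
  by have [i Ii <-] := crep_mem I g; exists (i^-1)%g; rewrite ?mulgK //; apply: opengrpV.
rewrite mulr1 (crep_inv _ (@ind_inv _ _ _ _ _)) big1_seq ?addr0 // => x /andP[_].
rewrite in_fsetD1 => /andP[xg]; rewrite in_fset_set // => /set_mem[Ix _].
case: asboolP => [/cg|_]; last by rewrite mulr0.
by move=> /(_ Ix) xE; rewrite xE eqxx in xg.
Qed.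

(** A map out of [X] is determined by its value at the indicator. *)
Lemma ind_hom_ext (V : smooth_rep k G) (a b : rep_hom X V) :
  a indicator = b indicator -> a = b.
Proof.
move=> ab; apply: rep_ext => f; rewrite (ind_expand f) !linear_sum.
by apply: eq_bigr => x _; rewrite !linearZ_LR /= !rep_equiv ab.
Qed.

Section HeckeModule.
Context (V : smooth_rep k G).
Notation H := (hecke k I).

Fact hecke_act_subproof (h : H) (v : invariants V) :
  inv_submod V (frob v ((h : rep_end X) indicator)).
Proof. by move=> i Ii; rewrite -!rep_equiv indicator_fixed. Qed.

(** [H = End_G(X)^op] acts on [V^I = Hom_G(X, V)] by precomposition. *)
Definition hecke_act (h : H) (v : invariants V) : invariants V :=
  in_smod (S := inv_submod V) (hecke_act_subproof h v).

Lemma frob_hecke_act h v : frob (hecke_act h v) = rep_comp (frob v) (h : rep_end X).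
Proof. by apply: ind_hom_ext; rewrite frob_indicator. Qed.

Lemma frobD (v w : invariants V) : frob (v + w) = frob v + frob w.
Proof.
apply: ind_hom_ext; rewrite frob_indicator.
by rewrite [RHS]/(frob v indicator + frob w indicator) !frob_indicator.
Qed.

Fact hecke_actA a b v : hecke_act a (hecke_act b v) = hecke_act (a * b) v.
Proof. by apply: inv_ext; rewrite -!frob_indicator !frob_hecke_act. Qed.
Fact hecke_act1 : left_id 1 hecke_act.
Proof. by move=> v; apply: inv_ext; rewrite -!frob_indicator !frob_hecke_act. Qed.
Fact hecke_actDr : right_distributive hecke_act +%R.
Proof.
move=> h v w; apply: inv_ext.
by rewrite -[LHS]frob_indicator -[RHS]frob_indicator frobD !frob_hecke_act frobD.
Qed.
Fact hecke_actDl v : {morph hecke_act^~ v : a b / a + b}.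
Proof.
move=> a b; apply: inv_ext.
rewrite -[LHS]frob_indicator -[RHS]frob_indicator frobD !frob_hecke_act.
exact: (linearD (frob v)).
Qed.
HB.instance Definition _ := GRing.Zmodule_isLmodule.Build H (invariants V)
  hecke_actA hecke_act1 hecke_actDr hecke_actDl.
End HeckeModule.

Section InvariantsMap.
Context (V W : smooth_rep k G) (f : rep_hom V W).

Fact inv_map_subproof (v : invariants V) : inv_submod W (f (inv_val v)).
Proof. by move=> i Ii; rewrite -rep_equiv inv_valP. Qed.

Definition inv_map_fun (v : invariants V) : invariants W :=
  in_smod (S := inv_submod W) (inv_map_subproof v).

Lemma frob_inv_map v : frob (inv_map_fun v) = rep_comp f (frob v).
Proof. by apply: ind_hom_ext; rewrite /= -/(frob _ _) !frob_indicator. Qed.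

Fact inv_map_linear : linear inv_map_fun.
Proof.
move=> h v w; apply: inv_ext.
rewrite [LHS]linearD /=.
have -> : inv_val (h *: inv_map_fun v + inv_map_fun w) =
    frob (hecke_act h (inv_map_fun v)) indicator + f (inv_val w).
  by rewrite frob_indicator.
by rewrite frob_hecke_act frob_inv_map.
Qed.
HB.instance Definition _ := GRing.isLinear.Build (hecke k I)
  (invariants V) (invariants W) _ inv_map_fun inv_map_linear.
Definition inv_map : {linear invariants V -> invariants W} := inv_map_fun.
End InvariantsMap.
End Frobenius.

Section FreeModule.
Context (k : fieldType) (S : choiceType).

Definition fin_supp (u : S -> k^o) : Prop := finite_set [set s | u s != 0].

Fact fin_supp0 : fin_supp 0.
Proof. by apply: (sub_finite_set _ (finite_set0 S)) => s /=; rewrite eqxx. Qed.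
Fact fin_suppD u v : fin_supp u -> fin_supp v -> fin_supp (u + v).
Proof.
move=> fu fv; apply: (sub_finite_set (B := [set s | u s != 0] `|` [set s | v s != 0])).
  move=> s /= uvs; have [us|us] := eqVneq (u s) 0; last by left.
  by right=> /=; apply: contraNneq uvs => vs; rewrite /GRing.add /= us vs addr0.
by rewrite finite_setU.
Qed.
Fact fin_suppZ a u : fin_supp u -> fin_supp (a *: u).
Proof.
apply: sub_finite_set => s /=; apply: contraNN => /eqP us.
by rewrite /GRing.scale /= us scaler0.
Qed.

(** The free [k]-vector space on [S]: finitely supported functions [S -> k]. *)
Definition free_submod : submod (S -> k^o) := Submod fin_supp0 fin_suppD fin_suppZ.
Definition free_mod : Type := smod free_submod.
HB.instance Definition _ := GRing.Lmodule.on free_mod.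

Definition free_fun (u : free_mod) : S -> k^o := val u.

Lemma free_ext (u v : free_mod) : free_fun u =1 free_fun v -> u = v.
Proof. by move=> uv; apply/val_inj/funext. Qed.

Fact free_delta_subproof (s : S) : fin_supp (fun t => (t == s)%:R).
Proof.
apply: (sub_finite_set _ (finite_set1 s)) => t /=.
by case: (t =P s) => // _; rewrite mulr0n eqxx.
Qed.
Definition free_delta (s : S) : free_mod := in_smod (S := free_submod) (free_delta_subproof s).
Lemma free_deltaE s t : free_fun (free_delta s) t = (t == s)%:R. Proof. by []. Qed.
End FreeModule.
Arguments free_delta {k S} s.

Section Tensor.
Context (k : fieldType) (p : nat) (G : topologicalGroupType).
Context (I : open_pro_p_subgroup p G).

Notation X := (ind_rep k I).
Notation H := (hecke k I).
Context (M : lmodType H).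
Notation XM := (X * M)%type.
Notation freeXM := (free_mod k XM).

Definition tensor_gen (x : X) (m : M) : freeXM := free_delta (x, m).

(** The defining relations of [X (x)_H M]; the right action of [H = End_G(X)^op]
    on [X] is [x h = h(x)]. *)
Definition tensor_relations : set freeXM := [set r |
  (exists x y m, r = tensor_gen (x + y) m - tensor_gen x m - tensor_gen y m) \/
  (exists x m n, r = tensor_gen x (m + n) - tensor_gen x m - tensor_gen x n) \/
  (exists a x m, r = tensor_gen (a *: x) m - a *: tensor_gen x m) \/
  (exists x (h : H) m, r = tensor_gen ((h : rep_end X) x) m - tensor_gen x (h *: m))].

Definition tensor : Type := qmod (submod_span tensor_relations).
HB.instance Definition _ := GRing.Lmodule.on tensor.

Definition tens (x : X) (m : M) : tensor := qproj (submod_span tensor_relations) (tensor_gen x m).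

(** [G] permutes the basis of the free module by [g (x, m) = (g x, m)]. *)
Fact free_act_subproof (g : G) (u : freeXM) :
  fin_supp (fun s : XM => free_fun u (act g^-1%g s.1, s.2)).
Proof.
apply: (sub_finite_set
    (B := (fun s : XM => (act g s.1, s.2)) @` [set s | free_fun u s != 0])).
  move=> [x m] /= us; exists (act g^-1%g x, m); first exact: us.
  exact: (congr1 (fun y => (y, m)) (actVK g x)).
exact/finite_image/(smodP u).
Qed.
Definition free_act (g : G) (u : freeXM) : freeXM :=
  in_smod (S := free_submod k XM) (free_act_subproof g u).

Lemma free_actE g u x m : free_fun (free_act g u) (x, m) = free_fun u (act g^-1%g x, m).
Proof. by []. Qed.

Fact free_act_linear g : linear (free_act g).
Proof. by move=> a u v; apply: free_ext. Qed.
HB.instance Definition _ g :=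
  GRing.isLinear.Build k freeXM freeXM _ (free_act g) (free_act_linear g).

Lemma free_act_gen g x m : free_act g (tensor_gen x m) = tensor_gen (act g x) m.
Proof.
apply: free_ext => -[y n]; rewrite free_actE /tensor_gen !free_deltaE.
congr (_%:R); congr nat_of_bool; apply/eqP/eqP => -[].
  by move=> <- ->; congr (_, _); exact/esym/actVK.
by move=> -> ->; congr (_, _); exact/actK.
Qed.

Fact free_act1 u : free_act 1%g u = u.
Proof. by apply: free_ext => -[x m]; rewrite free_actE invg1 act1. Qed.
Fact free_actM g h u : free_act (g * h)%g u = free_act g (free_act h u).
Proof. by apply: free_ext => -[x m]; rewrite !free_actE invgM actM. Qed.

Lemma tensor_relations_act g r : tensor_relations r -> tensor_relations (free_act g r).
Proof.
case=> [[x [y [m ->]]]|[[x [m [n ->]]]|[[a [x [m ->]]]|[x [h [m ->]]]]]].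
- by left; exists (act g x), (act g y), m; rewrite !linearB /= !free_act_gen linearD.
- by right; left; exists (act g x), m, n; rewrite !linearB /= !free_act_gen.
- right; right; left; exists a, (act g x), m.
  by rewrite linearB linearZ_LR /= !free_act_gen linearZ_LR.
- right; right; right; exists (act g x), h, m.
  by rewrite linearB /= !free_act_gen rep_equiv.
Qed.

Lemma span_relations_act g u :
  submod_span tensor_relations u -> submod_span tensor_relations (free_act g u).
Proof.
move=> uR.
have T0 : submod_span tensor_relations (free_act g 0) by rewrite linear0; apply: submod0.
have TD v w : submod_span tensor_relations (free_act g v) ->
    submod_span tensor_relations (free_act g w) -> submod_span tensor_relations (free_act g (v + w)).
  by move=> vS wS; rewrite linearD; apply: submodD.
have TZ a v : submod_span tensor_relations (free_act g v) ->
    submod_span tensor_relations (free_act g (a *: v)).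
  by move=> vS; rewrite linearZ_LR; apply: submodZ.
apply: (uR (Submod T0 TD TZ)) => r /= /(tensor_relations_act g) rR.
by move=> S; apply.
Qed.

Definition tensor_act (g : G) (t : tensor) : tensor :=
  qproj (submod_span tensor_relations) (free_act g (repr t)).

Lemma tensor_act_proj g u :
  tensor_act g (qproj _ u) = qproj (submod_span tensor_relations) (free_act g u).
Proof.
apply/qprojE; rewrite -linearB; apply/span_relations_act/qprojE.
by rewrite /qproj reprK.
Qed.

Lemma tensor_act_tens g x m : tensor_act g (tens x m) = tens (act g x) m.
Proof. by rewrite /tens tensor_act_proj free_act_gen. Qed.

Fact tensor_act_linear g : linear (tensor_act g).
Proof.
move=> a u v; have [x <-] := qproj_surj u; have [y <-] := qproj_surj v.
have -> : a *: qproj (submod_span tensor_relations) x + qproj (submod_span tensor_relations) y =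
  qproj (submod_span tensor_relations) (a *: x + y) by rewrite linearP.
rewrite [LHS]tensor_act_proj [free_act g _]linearP !tensor_act_proj.
exact: linearP.
Qed.
HB.instance Definition _ g :=
  GRing.isLinear.Build k tensor tensor _ (tensor_act g) (tensor_act_linear g).

Fact tensor_act1 t : tensor_act 1%g t = t.
Proof. by have [x <-] := qproj_surj t; rewrite tensor_act_proj free_act1. Qed.
Fact tensor_actM g h t : tensor_act (g * h)%g t = tensor_act g (tensor_act h t).
Proof. by have [x <-] := qproj_surj t; rewrite !tensor_act_proj free_actM. Qed.

Fact tensor_smooth t : open [set g | tensor_act g t = t].
Proof.
apply: open_stabilizer; [exact: tensor_act1|exact: tensor_actM|].
have [u <-] := qproj_surj t.
have /finite_fsetP[D DE] := smodP u; rewrite -/(free_fun u) in DE.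
have : nbhs (1%g : G) (\bigcap_(s in [set` D]) [set g | act g s.1 = s.1]).
  apply: filter_bigI => s _; apply: open_nbhs_nbhs; split; first exact: act_smooth.
  exact: act1.
apply: filterS => g gD /=; rewrite tensor_act_proj; congr qproj.
have key x m : free_fun u (x, m) != 0 -> act g x = x.
  by move=> us; apply: (gD (x, m)); rewrite -DE.
apply: free_ext => -[x m]; rewrite free_actE.
have [us|/key gx] := eqVneq (free_fun u (x, m)) 0; last first.
  by rewrite -{1}gx actK.
have [ugs|/key] := eqVneq (free_fun u (act g^-1%g x, m)) 0; first by rewrite us ugs.
by rewrite actVK => <-.
Qed.

(** [F M = X (x)_H M]. *)
Definition F_rep : smooth_rep k G :=
  @SmoothRep k G tensor tensor_act tensor_act1 tensor_actM tensor_smooth.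
End Tensor.

Section TransferredModel.
Context (k : fieldType) (p : nat) (G : topologicalGroupType).
Context (I : open_pro_p_subgroup p G).

Definition direct_summand (V T : smooth_rep k G) :=
  exists (W : smooth_rep k G) (i : rep_hom V T) (j : rep_hom W T),
  bijective (fun vw : V * W => i vw.1 + j vw.2).

Definition I_projective (V : smooth_rep k G) :=
  exists P : lmodType (hecke k I), projective P /\ direct_summand V (F_rep P).

Definition I_fib (V W : Rep k G) (f : hom V W) :=
  fib (gproj_model (hecke k I)) (inv_map I f).

Definition I_weq (V W : Rep k G) (f : hom V W) :=
  weq (gproj_model (hecke k I)) (inv_map I f).

Definition I_cof (V W : Rep k G) (f : hom V W) :=
  forall (Y Z : Rep k G) (q : hom Y Z), I_fib q -> I_weq q -> left_lifting f q.

Definition I_gproj_model : model_classes (Rep k G) :=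
  ModelClasses I_cof I_fib I_weq.
End TransferredModel.

(* Main.v *)
Require Import Defs.
From HB Require Import structures.
From mathcomp Require Import all_boot all_order all_algebra finmap.
From mathcomp Require Import all_classical topology.

Set Implicit Arguments.
Unset Strict Implicit.
Unset Printing Implicit Defensive.

Import GRing.Theory.

Local Open Scope classical_set_scope.
Local Open Scope ring_scope.

(** [U = (.)^I] denotes the functor of [I]-invariants. Let [XS S] be the direct
    sum of copies of [X] indexed by [S]: it is [F] of the free [H]-module on [S],
    and [U (XS S)] is that free module. If [U N] has finite projective dimension,
    some [XS S -> N] is a trivial fibration, so every map from the cofibrant [V]
    to [N] factors through some [XS S]. For a right homotopy [K : V -> P], where
    [P] is a path object with section [r : W -> P] of [p0] and [p1], this applies
    to [N = ker p0] and [K - r p0 K : V -> N], whose composite with [p1] is [g - f].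

    Conversely let [g - f = b a] with [a : V -> XS S]. The path object is
    [W + XS W^I], with [p1 = (id, t)] for the canonical [t : XS W^I -> W], along
    which [b] lifts. The cylinder is [V + XS S'], with [i1 = (id, j)], where all
    maps from [V] to [I]-projectives extend along [j : V -> XS S']. Such a [j] is a
    cofibration, because maps from [V] to the kernel of a trivial fibration factor
    through [I]-projectives. To find [j], take the smooth product [T] of copies of
    a large [XS S], one for each map from [V], and factor [V -> T] through [XS S'];
    this requires [U T], a product of free modules, to have finite projective
    dimension. It is flat since [H] is right noetherian. With [n = id H] and [D_i]
    the syzygies of a flat module, [D_(n+1)] is pure in a free module, hence
    [Ext^(n+1)(A, D_(n+1)) = 0] for finitely generated [A] and then for all [A] by
    Baer's criterion; so [Ext^1(D_n, D_(n+1)) = 0] and [D_n] is projective. *)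

(** * Projective and injective modules *)

Section LinearMaps.
Context (R : pzRingType).
Implicit Types A B K M N : lmodType R.

Lemma ex_linear A B (f : A -> B) : linear f -> exists g : {linear A -> B}, g =1 f.
Proof.
by move=> fl; exists (HB.pack_for {linear A -> B} f (GRing.isLinear.Build R A B _ f fl)).
Qed.

Lemma lin_factor M K B (e : {linear M -> K}) (f : {linear M -> B}) :
  onto e -> (forall x, e x = 0 -> f x = 0) ->
  exists g : {linear K -> B}, forall x, g (e x) = f x.
Proof.
move=> /choice[s sK] ef.
have fs x y : e x = e y -> f x = f y.
  move=> exy; apply/eqP; rewrite -subr_eq0 -linearB; apply/eqP/ef.
  by rewrite linearB exy subrr.
have [|g gE] := @ex_linear K B (fun x => f (s x)).
  by move=> a x y; rewrite -linearP; apply: fs; rewrite linearP !sK.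
by exists g => x; rewrite gE; apply: fs; rewrite sK.
Qed.

Lemma lin_lift A M N (i : {linear M -> N}) (f : {linear A -> N}) :
  injective i -> (forall a, exists m, i m = f a) ->
  exists g : {linear A -> M}, forall a, i (g a) = f a.
Proof.
move=> i_inj /choice[s sE].
have [|g gE] := @ex_linear A M s.
  by move=> a x y; apply: i_inj; rewrite linearP !sE linearP.
by exists g => a; rewrite gE.
Qed.

Definition smod_incl M (S : submod M) : {linear smod S -> M} := \val.

Lemma smod_incl_inj M (S : submod M) : injective (smod_incl S).
Proof. exact: val_inj. Qed.

Definition ses A B K (i : {linear A -> B}) (e : {linear B -> K}) :=
  [/\ injective i, onto e & forall x, e x = 0 <-> exists y, i y = x].

Lemma ses_kernel A B (e : {linear A -> B}) : onto e -> ses (smod_incl (lin_kernel e)) e.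
Proof.
move=> e_onto; split=> // x.
by split=> [ex|[y <-]]; [exists (in_smod (S := lin_kernel e) ex)|exact: (smodP y)].
Qed.

Lemma ses_quotient M (S : submod M) : ses (smod_incl S) (qproj S).
Proof.
split=> [||x]; [exact: smod_incl_inj|exact: qproj_surj|].
split=> [|[y <-]].
  by rewrite -(linear0 (qproj S)) => /qprojE; rewrite subr0 => Sx; exists (in_smod Sx).
by rewrite -(linear0 (qproj S)); apply/qprojE; rewrite subr0; exact: (smodP y).
Qed.

Lemma ses_comp A B K (i : {linear A -> B}) (e : {linear B -> K}) x :
  ses i e -> e (i x) = 0.
Proof. by case=> _ _ ie; apply/ie; exists x. Qed.

Lemma lin_inj0 A B (f : {linear A -> B}) : (forall x, f x = 0 -> x = 0) -> injective f.
Proof.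
by move=> f0 x y fxy; apply/eqP; rewrite -subr_eq0; apply/eqP/f0; rewrite linearB fxy subrr.
Qed.
End LinearMaps.

(** * Projective modules and finite projective dimension *)

Section Projective.
Context (R : pzRingType).
Implicit Types A B K M N P : lmodType R.

Lemma projective_retract P M (a : {linear M -> P}) (b : {linear P -> M}) :
  (forall x, b (a x) = x) -> projective P -> projective M.
Proof.
move=> abK projP L N e f e_onto.
have [h hE] := projP L N e (lin_comp f b) e_onto.
by exists (lin_comp h a) => x; exact: etrans (hE (a x)) (congr1 f (abK x)).
Qed.

Lemma projective_zero M : (forall x : M, x = 0) -> projective M.
Proof.
move=> M0 L N e f _; have [|h hE] := @ex_linear _ M L (fun=> 0).
  by move=> a x y; rewrite scaler0 addr0.
by exists h => x; rewrite (M0 x) /= !linear0.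
Qed.

Lemma projective_sum P Q : projective P -> projective Q -> projective (P * Q)%type.
Proof.
move=> projP projQ M N e f e_onto.
have [|i iE] := @ex_linear _ P (P * Q)%type (fun x => (x, 0)).
  by move=> a x y; apply/pair_eqP/andP; split; apply/eqP; rewrite /= ?scaler0 ?addr0.
have [|j jE] := @ex_linear _ Q (P * Q)%type (fun y => (0, y)).
  by move=> a x y; apply/pair_eqP/andP; split; apply/eqP; rewrite /= ?scaler0 ?addr0.
have [h hE] := projP _ _ e (lin_comp f i) e_onto.
have [h' h'E] := projQ _ _ e (lin_comp f j) e_onto.
have [|g gE] := @ex_linear _ (P * Q)%type M (fun z => h z.1 + h' z.2).
  by move=> a x y /=; rewrite !linearP scalerDr addrACA.
exists g => -[x y]; rewrite /= gE linearD.
have := hE x; have := h'E y; rewrite /= iE jE => -> ->; rewrite -linearD.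
by congr (f (_, _)); rewrite /= ?addr0 ?add0r.
Qed.

Lemma fpd_zero M : (forall x : M, x = 0) -> finite_projective_dimension M.
Proof.
move=> M0; exists (fun=> M), idfun, (fun=> idfun), 0%N; split=> //.
- by move=> _; apply: projective_zero.
- by move=> x; exists x.
- by apply/seteqP; split=> x _ //=; exists x.
- by move=> _; apply/seteqP; split=> x _ //=; exists x.
Qed.

(** Splicing: [P] becomes degree 0 and the resolution of [K] is shifted up by one. *)
Lemma fpd_ses K P M (i : {linear K -> P}) (e : {linear P -> M}) :
  ses i e -> projective P -> finite_projective_dimension K ->
  finite_projective_dimension M.
Proof.
move=> [i_inj e_onto ie] projP [Q [q [d [n [projQ q_onto q_ker d_ker Q0]]]]].
pose Q' j := if j is l.+1 then Q l else P.
pose d' j : {linear Q' j.+1 -> Q' j} :=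
  if j is l.+1 then d l else lin_comp i q.
exists Q', e, d', n.+1; split=> //.
- by case.
- apply/seteqP; split=> x /=.
    by move/ie => [y <-]; have [z <-] := q_onto y; exists z.
  by move=> [z <-]; apply/ie; exists (q z).
- case=> [|j]; last exact: d_ker.
  rewrite -q_ker; apply/seteqP; split=> x /=.
    by rewrite -(linear0 i) => /i_inj.
  by move=> ->; rewrite linear0.
- by case=> // j nj x; apply: Q0.
Qed.

Lemma fpd_projective P : projective P -> finite_projective_dimension P.
Proof.
move=> projP; have [|i iE] := @ex_linear _ (smod (lin_kernel (@idfun P))) P (fun=> 0).
  by move=> a x y; rewrite scaler0 addr0.
apply: (@fpd_ses _ P P (smod_incl (lin_kernel (@idfun P))) idfun) => //.
  by apply: ses_kernel => x; exists x.
by apply: fpd_zero => x; apply: val_inj; apply: (smodP x).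
Qed.

Lemma fpd_iso M N (a : {linear M -> N}) : bijective a ->
  finite_projective_dimension M -> finite_projective_dimension N.
Proof.
move=> a_bij [Q [q [d [n [projQ q_onto q_ker d_ker Q0]]]]].
exists Q, (lin_comp a q), d, n; split=> //.
  have [b ab ba] := a_bij => y; have [x xE] := q_onto (b y).
  by exists x; rewrite /= xE.
rewrite -q_ker; apply/seteqP; split=> x /=; last by move=> ->; rewrite linear0.
by rewrite -(linear0 a) => /(bij_inj a_bij).
Qed.

(** Dropping degree 0 of a finite resolution leaves a resolution of the kernel of the
    augmentation. *)
Lemma fpd_cover M : finite_projective_dimension M ->
  exists (P : lmodType R) (e : {linear P -> M}),
    [/\ projective P, onto e & finite_projective_dimension (smod (lin_kernel e))].
Proof.
move=> [Q [q [d [n [projQ q_onto q_ker d_ker Q0]]]]].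
exists (Q 0%N), q; split=> //.
have [|x|e eE] := @lin_lift _ (Q 1%N) _ _ (smod_incl (lin_kernel q)) (d 0%N).
- exact: smod_incl_inj.
- have : lin_kernel q (d 0%N x) by rewrite q_ker; exists x.
  by move=> qdx; exists (in_smod qdx).
exists (fun j => Q j.+1), e, (fun j => d j.+1), n; split=> //.
- move=> y; have : lin_image (d 0%N) (val y) by rewrite -q_ker; exact: (smodP y).
  by move=> [x xE]; exists x; apply: val_inj; rewrite -xE -(eE x).
- rewrite -d_ker; apply/seteqP; split=> x /=; rewrite -(eE x); first by move=> ->.
  exact: (@val_inj _ _ _ (e x) 0).
- by move=> j nj; apply: Q0; apply: ltnW.
Qed.
End Projective.

(** * Baer's criterion *)

Section Baer.
Context (R : pzRingType).

Lemma Baer (B : lmodType R) :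
  (forall (J : submod R^o) (f : {linear smod J -> B}),
     exists g : {linear R^o -> B}, forall x, g (smod_incl J x) = f x) ->
  injective_module B.
Proof.
move=> extB M N m f m_inj.
(* A good set is the graph of a partial extension of [f], defined on a submodule of [N] containing
   the image of [m]; the fourth clause makes it single-valued. *)
pose good (A : set (N * B)) := [/\ A 0, forall u v, A u -> A v -> A (u + v),
  forall a u, A u -> A (a *: u), forall b, A (0, b) -> b = 0 & forall x, A (m x, f x)].
have [|A [PA Amax]] := @Zorn_bigcup (N * B)%type (fun A => A = set0 \/ good A).
  move=> F FP Ftot; have [[X [FX X0]]|F0] := pselect (exists X, F X /\ X <> set0); last first.
    left; apply/seteqP; split=> // u [X FX Xu]; apply: F0; exists X; split=> // X0.
    by rewrite X0 in Xu.
  have goodF Y u : F Y -> Y u -> good Y.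
    by move=> FY Yu; case: (FP _ FY) => // Y0; rewrite Y0 in Yu.
  have goodX : good X by case: (FP _ FX) => // /X0.
  right; split.
  - by exists X => //; case: goodX.
  - move=> u v [Y FY Yu] [Z FZ Zv]; case: (Ftot _ _ FY FZ) => [YZ|ZY].
      by exists Z => //; have [_ + _ _ _] := goodF _ _ FZ Zv; apply=> //; apply: YZ.
    by exists Y => //; have [_ + _ _ _] := goodF _ _ FY Yu; apply=> //; apply: ZY.
  - move=> a u [Y FY Yu]; exists Y => //.
    by have [_ _ + _ _] := goodF _ _ FY Yu; apply.
  - by move=> b [Y FY Yb]; have [_ _ _ + _] := goodF _ _ FY Yb; apply.
  - by move=> x; exists X => //; case: goodX.
have goodA : good A.
  case: PA => // A0; exfalso.
  apply: (Amax [set u | exists x, (m x, f x) = u]).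
    by rewrite A0; split=> [//|/(_ (m 0, f 0)) []]; exists 0.
  right; split.
  - by exists 0; rewrite !linear0.
  - by move=> _ _ [x <-] [y <-]; exists (x + y); rewrite !linearD.
  - by move=> a _ [x <-]; exists (a *: x); rewrite !linearZ_LR.
  - by move=> b [x [] + <-]; rewrite -(linear0 m) => /m_inj ->; rewrite linear0.
  - by move=> x; exists x.
have [A0 AD AZ Afun Af] := goodA.
have Auniq x b c : A (x, b) -> A (x, c) -> b = c.
  move=> Ab /(AZ (-1)) /(AD _ _ Ab).
  have -> : (x, b) + (-1) *: (x, c) = (0, b - c).
    by apply/pair_eqP/andP; split; apply/eqP; rewrite /= scaleN1r ?subrr.
  by move=> /Afun /eqP; rewrite subr_eq0 => /eqP.
(* The scalars carrying [y] into the domain form an ideal [J]; the partial map on [J] extends to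
   [R], and its value [b0] at 1 allows [y] to be adjoined. *)
have Atot y : exists b, A (y, b).
  have J0 : exists b, A (0 *: y, b) by exists 0; rewrite scale0r.
  have JD (r s : R) : (exists b, A (r *: y, b)) -> (exists b, A (s *: y, b)) ->
      exists b, A ((r + s) *: y, b).
    by move=> [b Ab] [c Ac]; exists (b + c); rewrite scalerDl; exact: (AD _ _ Ab Ac).
  have JZ a (r : R) : (exists b, A (r *: y, b)) -> exists b, A ((a * r) *: y, b).
    by move=> [b Ab]; exists (a *: b); rewrite -scalerA; exact: (AZ a _ Ab).
  pose J := Submod (V := R^o) J0 JD JZ.
  have /choice[c cA] (r : smod J) : exists b, A ((val r : R) *: y, b) by exact: (smodP r).
  have [|h hE] := @ex_linear _ (smod J) B c.
    move=> a r s; apply: (Auniq ((a * (val r : R) + val s) *: y)).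
      exact: (cA (a *: r + s)).
    by rewrite scalerDl -scalerA; exact: (AD _ _ (AZ a _ (cA _)) (cA _)).
  have [g gE] := extB J h; pose b0 := g 1.
  have gA (r : R) b : A (r *: y, b) -> A (r *: y, r *: b0).
    move=> Ab; have Jr : J r by exists b.
    have := cA (in_smod Jr); rewrite -hE -gE /=.
    suff -> : g r = r *: b0 by [].
    by rewrite /b0 -linearZ_LR; congr (g _); exact/esym/mulr1.
  pose A' := [set u : N * B | exists x b (r : R), A (x, b) /\ u = (x + r *: y, b + r *: b0)].
  have AA' : A `<=` A'.
    by move=> [x b] Ab; exists x, b, 0; rewrite !scale0r !addr0.
  have A'y : A' (y, b0) by exists 0, 0, 1; rewrite !scale1r !add0r.
  exists b0; apply: contrapT => nA; apply: (Amax A').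
    by split=> // /(_ _ A'y).
  right; split.
  - exact: AA'.
  - move=> _ _ [x [b [r [Ab ->]]]] [x' [b' [r' [Ab' ->]]]].
    exists (x + x'), (b + b'), (r + r'); split; first exact: (AD _ _ Ab Ab').
    by rewrite !scalerDl; apply/pair_eqP/andP; split; apply/eqP; rewrite /= addrACA.
  - move=> a _ [x [b [r [Ab ->]]]].
    exists (a *: x), (a *: b), (a * r); split; first exact: (AZ a _ Ab).
    by rewrite -!scalerA; apply/pair_eqP/andP; split; apply/eqP; rewrite /= scalerDr.
  - move=> d [x [b [r [Ab [xE ->]]]]].
    have xr : x = (- r) *: y by apply/eqP; rewrite scaleNr -addr_eq0 -xE.
    rewrite xr in Ab; rewrite (Auniq _ _ _ Ab (gA _ _ Ab)).
    by rewrite scaleNr addNr.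
  - by move=> x; apply/AA'/Af.
have /choice[c cA] := Atot.
have [|h hE] := @ex_linear _ N B c.
  by move=> a x y; apply: Auniq (cA _) _; exact: (AD _ _ (AZ a _ (cA _)) (cA _)).
by exists h => x; rewrite /= hE; apply: Auniq (cA _) (Af _).
Qed.
End Baer.

(** An ideal of a field is zero or everything, so Baer's criterion applies at once. *)
Lemma vector_space_injective (k : fieldType) (V : lmodType k) : injective_module V.
Proof.
apply: Baer => J f; have [[a [Ja a0]]|J0] := pselect (exists a : k, J a /\ a != 0).
  have J1 : J (1 : k) by rewrite -(mulVf a0); apply: (submodZ (s := J)).
  have [|g gE] := @ex_linear _ k^o V (fun x => (x : k) *: f (in_smod (S := J) J1)).
    by move=> b x y; rewrite scalerDl -scalerA.
  exists g => x; rewrite gE -linearZ_LR; congr (f _); apply: val_inj.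
  exact: mulr1.
have [|g gE] := @ex_linear _ k^o V (fun=> 0); first by move=> b x y; rewrite scaler0 addr0.
exists g => x; rewrite gE; suff -> : x = 0 by rewrite linear0.
apply: val_inj; apply: contrapT => x0; apply: J0; exists (val x); split.
  exact: (smodP x).
exact/eqP.
Qed.

(** * Enough injectives by coinduction from a field *)

Definition enough_injectives (R : pzRingType) := forall M : lmodType R,
  exists (E : lmodType R) (j : {linear M -> E}), injective_module E /\ injective j.

Section Coinduction.
Context (k : fieldType) (R : pzRingType) (s : {rmorphism k -> R}).

(** An alias, so that the [k]-structure obtained through [s] does not clash with the
    [R]-structure. *)
Definition restrict (M : lmodType R) : Type := M.

Section Restriction.
Context (M : lmodType R).
HB.instance Definition _ := GRing.Zmodule.on (restrict M).
Let rscale (a : k) (v : restrict M) : restrict M := s a *: (v : M).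
Fact rscaleA a b v : rscale a (rscale b v) = rscale (a * b) v.
Proof. by rewrite /rscale scalerA rmorphM. Qed.
Fact rscale1 : left_id 1 rscale.
Proof. by move=> v; rewrite /rscale rmorph1 scale1r. Qed.
Fact rscaleDr : right_distributive rscale +%R.
Proof. by move=> a u v; apply: scalerDr. Qed.
Fact rscaleDl v : {morph rscale^~ v : a b / a + b}.
Proof. by move=> a b; rewrite /rscale rmorphD scalerDl. Qed.
HB.instance Definition _ := GRing.Zmodule_isLmodule.Build k (restrict M)
  rscaleA rscale1 rscaleDr rscaleDl.
Lemma restrict_scaleE a (v : restrict M) : a *: v = s a *: (v : M). Proof. by []. Qed.
End Restriction.

Section CoinducedModule.
Context (M : lmodType R).

(** These functions form [Hom_k(R, M)], on which [R] acts by right translation of the argument. *)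
Definition coind_set (f : R -> restrict M) : Prop :=
  (forall x y, f (x + y) = f x + f y) /\ forall a x, f (s a * x) = a *: f x.
Fact coind0 : coind_set 0.
Proof. by split=> [x y|a x]; rewrite ?addr0 ?scaler0. Qed.
Fact coindD f g : coind_set f -> coind_set g -> coind_set (f + g).
Proof.
have E x : (f + g) x = f x + g x by [].
move=> [fD fZ] [gD gZ]; split=> [x y|a x]; rewrite !E; first by rewrite fD gD addrACA.
by rewrite fZ gZ scalerDr.
Qed.
Fact coindZ a f : coind_set f -> coind_set (a *: f).
Proof.
have E x : (a *: f) x = a *: f x by [].
move=> [fD fZ]; split=> [x y|b x]; rewrite !E; first by rewrite fD scalerDr.
by rewrite fZ !scalerA mulrC.
Qed.
Definition coind_submod := Submod coind0 coindD coindZ.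
Definition coind : Type := smod coind_submod.
HB.instance Definition _ := GRing.Zmodule.on coind.

Definition coind_fun (f : coind) : R -> M := val f.
Lemma coind_ext (f g : coind) : coind_fun f =1 coind_fun g -> f = g.
Proof. by move=> fg; apply/val_inj/funext. Qed.
Lemma coind_funD (f : coind) x y : coind_fun f (x + y) = coind_fun f x + coind_fun f y.
Proof. by have [+ _] := smodP f; exact. Qed.
Lemma coind_funZ (f : coind) a x : coind_fun f (s a * x) = s a *: coind_fun f x.
Proof. by have [_] := smodP f; exact. Qed.

Fact coind_scale_subproof h (f : coind) :
  coind_set (fun x => coind_fun f (x * h) : restrict M).
Proof.
by split=> [x y|a x]; rewrite ?mulrDl ?coind_funD // -mulrA coind_funZ.
Qed.
Definition coind_scale h (f : coind) : coind :=
  in_smod (S := coind_submod) (coind_scale_subproof h f).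
Fact coind_scaleA a b f : coind_scale a (coind_scale b f) = coind_scale (a * b) f.
Proof. by apply: coind_ext => x; rewrite /coind_fun /= mulrA. Qed.
Fact coind_scale1 : left_id 1 coind_scale.
Proof. by move=> f; apply: coind_ext => x; rewrite /coind_fun /= mulr1. Qed.
Fact coind_scaleDr : right_distributive coind_scale +%R.
Proof. by move=> a f g; apply: coind_ext. Qed.
Fact coind_scaleDl f : {morph coind_scale^~ f : a b / a + b}.
Proof.
by move=> a b; apply: coind_ext => x; rewrite {1}/coind_fun /= mulrDr coind_funD.
Qed.
HB.instance Definition _ := GRing.Zmodule_isLmodule.Build R coind
  coind_scaleA coind_scale1 coind_scaleDr coind_scaleDl.

Lemma coind_funDE (f g : coind) x : coind_fun (f + g) x = coind_fun f x + coind_fun g x.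
Proof. by []. Qed.
Lemma coind_scaleE h (f : coind) x : coind_fun (h *: f) x = coind_fun f (x * h).
Proof. by []. Qed.

(** Evaluation at 1 turns [R]-maps into [coind] into [k]-linear maps into [M], and the latter extend
    because vector spaces are injective. *)
Lemma coind_injective : injective_module coind.
Proof.
move=> A N m f m_inj.
have [|f1 f1E] := @ex_linear k (restrict A) (restrict M) (fun a => coind_fun (f a) 1).
  move=> a x y; rewrite !restrict_scaleE linearP coind_funDE coind_scaleE.
  by rewrite mul1r -[in LHS](mulr1 (s a)) coind_funZ.
have [|m1 m1E] := @ex_linear k (restrict A) (restrict N) m.
  by move=> a x y; rewrite !restrict_scaleE linearP.
have m1_inj : injective m1 by move=> x y; rewrite !m1E; apply: m_inj.
have [g gE] := @vector_space_injective k (restrict M) (restrict A) (restrict N) m1 f1 m1_inj.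
have gD (x y : N) : g (x + y) = g x + g y by exact: (linearD g).
have gZ a (x : N) : g (s a *: x) = s a *: (g x : M) by exact: (linearZ_LR g a x).
have gc n : coind_set (fun x => g (x *: (n : N)) : restrict M).
  by split=> [x y|a x]; rewrite ?scalerDl ?gD // -scalerA gZ.
have [|h hE] := @ex_linear R N coind (fun n => in_smod (S := coind_submod) (gc n)).
  move=> a x y; apply: coind_ext => z; rewrite coind_funDE coind_scaleE.
  by rewrite /coind_fun /= scalerDr gD scalerA.
exists h => a; apply: coind_ext => x; rewrite /= hE /coind_fun /=.
rewrite -linearZ_LR -m1E; have := gE (x *: a); rewrite /= => ->.
by rewrite f1E linearZ_LR coind_scaleE mul1r.
Qed.

Lemma coind_embedding : exists j : {linear M -> coind}, injective j.
Proof.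
have jc (v : M) : coind_set (fun x => x *: v : restrict M).
  by split=> [x y|a x]; rewrite ?scalerDl // -scalerA.
have [|j jE] := @ex_linear R M coind (fun v => in_smod (S := coind_submod) (jc v)).
  by move=> a u v; apply: coind_ext => x; rewrite coind_funDE coind_scaleE
    /coind_fun /= scalerDr scalerA.
exists j => u v; rewrite !jE => /(congr1 (fun f => coind_fun f 1)).
by rewrite /coind_fun /= !scale1r.
Qed.
End CoinducedModule.

Lemma algebra_enough_injectives : enough_injectives R.
Proof.
move=> M; have [j j_inj] := coind_embedding M.
by exists (coind M), j; split; [exact: coind_injective|].
Qed.
End Coinduction.

(** * Direct sums of copies of a module, and free modules *)

Section FiniteSupport.
Context (R : pzRingType) (V : lmodType R) (S : choiceType).

Definition fs_set (u : S -> V) : Prop := finite_set [set s | u s != 0].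
Fact fs0 : fs_set 0.
Proof. by apply: (sub_finite_set _ (finite_set0 S)) => s /=; rewrite eqxx. Qed.
Fact fsD u v : fs_set u -> fs_set v -> fs_set (u + v).
Proof.
move=> fu fv; apply: (sub_finite_set (B := [set s | u s != 0] `|` [set s | v s != 0])).
  move=> s /= uvs; have [us|us] := eqVneq (u s) 0; last by left.
  by right=> /=; apply: contraNneq uvs => vs; rewrite /GRing.add /= us vs addr0.
by rewrite finite_setU.
Qed.
Fact fsZ a u : fs_set u -> fs_set (a *: u).
Proof.
apply: sub_finite_set => s /=; apply: contraNN => /eqP us.
by rewrite /GRing.scale /= us scaler0.
Qed.

(** Used twice: with [V = R^o] it is the free module, with [V = X] it underlies [XS]. *)
Definition fsupp : Type := smod (Submod fs0 fsD fsZ).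
HB.instance Definition _ := GRing.Lmodule.on fsupp.
Definition fs_fun (u : fsupp) : S -> V := val u.
HB.instance Definition _ := GRing.Linear.copy fs_fun
  (smod_incl (Submod fs0 fsD fsZ) : fsupp -> (S -> V)).

Lemma fs_ext u v : fs_fun u =1 fs_fun v -> u = v.
Proof. by move=> uv; apply/val_inj/funext. Qed.

Lemma fs_funP a u v s : fs_fun (a *: u + v) s = a *: fs_fun u s + fs_fun v s.
Proof. by []. Qed.

Fact fs_single_subproof s x : fs_set (fun t => if t == s then x else 0).
Proof.
apply: (sub_finite_set _ (finite_set1 s)) => t /=.
by case: (t =P s) => // _; rewrite eqxx.
Qed.
Definition fs_single s x : fsupp :=
  in_smod (S := Submod fs0 fsD fsZ) (fs_single_subproof s x).
Lemma fs_singleE s x t : fs_fun (fs_single s x) t = if t == s then x else 0.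
Proof. by []. Qed.
Fact fs_single_linear s : linear (fs_single s).
Proof.
move=> a x y; apply: fs_ext => t; rewrite fs_funP !fs_singleE.
by case: eqP => // _; rewrite scaler0 addr0.
Qed.
HB.instance Definition _ s :=
  GRing.isLinear.Build R V fsupp _ (fs_single s) (fs_single_linear s).

Lemma fs_finite u : finite_set [set s | fs_fun u s != 0].
Proof. exact: (smodP u). Qed.

Lemma fs_expand u (D : set S) : finite_set D -> [set s | fs_fun u s != 0] `<=` D ->
  u = \sum_(s <- fset_set D) fs_single s (fs_fun u s).
Proof.
move=> finD uD; apply: fs_ext => t; rewrite linear_sum fct_sumE /=.
have [ut|ut] := eqVneq (fs_fun u t) 0.
  rewrite ut big1_seq // => s _; rewrite fs_singleE.
  by case: eqP => // <-.
rewrite (big_fsetD1 t) /=; last by rewrite in_fset_set // inE; apply: uD.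
rewrite fs_singleE eqxx big1_seq ?addr0 // => s /andP[_].
by rewrite in_fsetD1 fs_singleE eq_sym => /andP[/negbTE ->].
Qed.

Lemma fs_hom_ext (B : lmodType R) (f g : {linear fsupp -> B}) :
  (forall s x, f (fs_single s x) = g (fs_single s x)) -> f =1 g.
Proof.
move=> fg u; rewrite (@fs_expand u _ (fs_finite u) (fun s us => us)) !linear_sum.
by apply: eq_bigr => s _; apply: fg.
Qed.

Lemma fs_universal (B : lmodType R) (f : S -> {linear V -> B}) :
  exists F : {linear fsupp -> B}, forall s x, F (fs_single s x) = f s x.
Proof.
pose supp u := [set s | fs_fun u s != 0].
pose F u := \sum_(s <- fset_set (supp u)) f s (fs_fun u s).
(* Any finite set containing the support may index the sum, so linearity can be checked on a common
   index set. *)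
have FE u D : finite_set D -> supp u `<=` D ->
    F u = \sum_(s <- fset_set D) f s (fs_fun u s).
  move=> finD uD; apply: big_fset_incl => [|s sD].
    by rewrite -fset_set_sub //; exact: fs_finite.
  rewrite in_fset_set; last exact: fs_finite.
  by move/negP; rewrite in_setE /supp /= => /negP; rewrite negbK => /eqP ->; rewrite linear0.
have [|F' F'E] := @ex_linear _ fsupp B F.
  move=> a u v; have finD : finite_set (supp u `|` supp v).
    by rewrite finite_setU; split; apply: fs_finite.
  rewrite !(FE _ _ finD); last 3 first.
  - by move=> s; right.
  - by move=> s; left.
  - move=> s; rewrite /supp /=; have [us|us _] := eqVneq (fs_fun u s) 0; last by left.
    have [vs|vs _] := eqVneq (fs_fun v s) 0; last by right.
    by rewrite fs_funP us vs scaler0 addr0 eqxx.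
  rewrite scaler_sumr -big_split /=; apply: eq_bigr => s _.
  by rewrite fs_funP linearP.
exists F' => s x; rewrite F'E (FE _ [set s]) //; last first.
  by move=> t; rewrite /supp /= fs_singleE; case: (t =P s) => // _; rewrite eqxx.
by rewrite fset_set1 big_seq_fset1 fs_singleE eqxx.
Qed.
End FiniteSupport.

Section FreeModules.
Context (R : pzRingType).
Implicit Types (A B K M N P : lmodType R) (S : choiceType).

Definition freemod S : lmodType R := fsupp R^o S.
Definition free_gen S (s : S) : freemod S := fs_single (V := R^o) s 1.

Lemma free_gen_scale S (s : S) (x : R) : fs_single s (x : R^o) = x *: free_gen s.
Proof.
rewrite /free_gen -(linearZ_LR (fs_single (V := R^o) s)); congr (fs_single _ _).
exact/esym/mulr1.
Qed.

Lemma free_universal S B (b : S -> B) :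
  exists f : {linear freemod S -> B}, forall s, f (free_gen s) = b s.
Proof.
have /choice[c cE] s : exists c : {linear R^o -> B}, forall x : R, c x = x *: b s.
  by apply: ex_linear => a x y; rewrite scalerDl -scalerA.
by have [f fE] := fs_universal c; exists f => s; rewrite fE cE scale1r.
Qed.

Lemma free_hom_ext S B (f g : {linear freemod S -> B}) :
  (forall s, f (free_gen s) = g (free_gen s)) -> f =1 g.
Proof.
move=> fg; apply: fs_hom_ext => s x.
by rewrite free_gen_scale !linearZ_LR fg.
Qed.

Lemma projective_free S : projective (freemod S).
Proof.
move=> M N e f e_onto; have /choice[m mE] s := e_onto (f (free_gen s)).
have [h hE] := free_universal m; exists h.
by apply: (@free_hom_ext S N (lin_comp e h)) => s; rewrite /= hE mE.
Qed.

Lemma free_cover M : exists e : {linear freemod M -> M}, onto e.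
Proof.
by have [e eE] := @free_universal M M id; exists e => x; exists (free_gen x); rewrite eE.
Qed.

(** For a section [s] of a free cover [f] of the projective cover [P], the kernel of [q f] is
    [s(ker q)] plus the projective module [L = ker f]. A projective cover [r] of [ker q] then gives
    a cover by [Q * L] with the same kernel as [r]. *)
Lemma fpd_free_cover M : finite_projective_dimension M ->
  exists (S : choiceType) (e : {linear freemod S -> M}),
    onto e /\ finite_projective_dimension (smod (lin_kernel e)).
Proof.
move=> /fpd_cover[P [q [projP q_onto fpdK]]].
have [f f_onto] := free_cover P.
have [s sK'] := projP _ _ f idfun f_onto.
have sK x : f (s x) = x by exact: sK' x.
exists P, (lin_comp q f); split.
  by move=> y; have [x <-] := q_onto y; have [u <-] := f_onto x; exists u.
pose K := smod (lin_kernel q); pose L := smod (lin_kernel f).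
have [Q [r [projQ r_onto fpdr]]] := fpd_cover fpdK.
have projL : projective L.
  have [|g gE] := @lin_lift R (freemod P) L _ (smod_incl _) (idfun \- lin_comp s f)
    (@smod_incl_inj _ _ _).
    move=> u; have uL : lin_kernel f (u - s (f u)).
      by rewrite /= linearB (sK (f u)) subrr.
    by exists (in_smod uL).
  apply: (projective_retract (a := smod_incl _) (b := g)); last exact: projective_free.
  move=> x; apply: (@smod_incl_inj _ _ (lin_kernel f)); rewrite gE /=.
  by have /= -> := smodP x; rewrite linear0 subr0.
have [|h hE] := @ex_linear R (Q * L)%type (freemod P) (fun z => s (val (r z.1)) + val z.2).
  move=> a x y; rewrite /= linearP -/(smod_incl (lin_kernel q)) -/(smod_incl (lin_kernel f)).
  by rewrite !linearP /= scalerDr addrACA.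
have hK z : lin_kernel (lin_comp q f) (h z).
  rewrite /= hE linearD (sK _) /=; have /= -> := smodP z.2.
  by rewrite addr0; exact: (smodP (r z.1)).
have [|g gE] := @lin_lift R _ (smod (lin_kernel (lin_comp q f))) _ (smod_incl _) h
    (@smod_incl_inj _ _ _).
  by move=> z; exists (in_smod (hK z)).
have [|i iE] := @ex_linear R (smod (lin_kernel r)) (Q * L)%type (fun x => (val x, 0)).
  by move=> a x y; apply/pair_eqP/andP; split; apply/eqP; rewrite /= ?scaler0 ?addr0.
apply: (fpd_ses (i := i) (e := g)) fpdr; last exact: projective_sum.
split.
- by move=> x y; rewrite !iE => -[] /val_inj.
- move=> y; have qfy : q (f (val y)) = 0 := smodP y.
  have [x xE] := r_onto (in_smod (S := lin_kernel q) qfy).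
  have Ly : lin_kernel f (val y - s (f (val y))) by rewrite /= linearB (sK _) subrr.
  exists (x, in_smod Ly); apply: (@smod_incl_inj _ _ (lin_kernel (lin_comp q f))).
  by rewrite gE hE /= xE /= addrCA subrr addr0.
- move=> [x y]; split=> [/(congr1 (smod_incl _))|[z]].
    rewrite gE hE linear0 /= => xy0.
    have rx0 : r x = 0.
      apply: val_inj => /=; rewrite -(sK (val (r x))) /=.
      have /(congr1 f) := xy0; rewrite linearD linear0 => <-.
      by have /= -> := smodP y; rewrite addr0.
    exists (in_smod (S := lin_kernel r) rx0); rewrite iE; congr (_, _).
    by apply: val_inj; move: xy0; rewrite rx0 linear0 add0r.
  rewrite iE => -[<- <-]; apply: (@smod_incl_inj _ _ (lin_kernel (lin_comp q f))).
  by rewrite gE hE linear0 /=; have /= -> := smodP z; rewrite linear0 addr0.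
Qed.
End FreeModules.

(** * Vanishing of Ext *)

Section Extensions.
Context (R : pzRingType).
Implicit Types A B E K M N P Q : lmodType R.

(** [Ext^1(K, B) = 0]. *)
Definition ext1_zero K B := forall M N (i : {linear M -> N}) (e : {linear N -> K}),
  ses i e -> forall f : {linear M -> B},
  exists g : {linear N -> B}, forall x, g (i x) = f x.

(** Every extension [N] of [K] by [M] is a pushout of [P] along some [m : K' -> M], so it suffices
    to extend [f m] to [P]. *)
Lemma ext1_presentation K' P K B (i : {linear K' -> P}) (e : {linear P -> K}) :
  ses i e -> projective P ->
  (forall f : {linear K' -> B}, exists g : {linear P -> B}, forall x, g (i x) = f x) ->
  ext1_zero K B.
Proof.
move=> ie projP extP M N i1 e1 ie1 f; have [i_inj e_onto iex] := ie.
have [i1_inj e1_onto ie1x] := ie1.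
have [l lE'] := projP _ _ e1 e e1_onto; have lE x : e1 (l x) = e x by exact: lE' x.
have [|m mE] := @lin_lift _ _ _ _ i1 (lin_comp l i) i1_inj.
  by move=> x; apply/ie1x; rewrite lE (ses_comp x ie).
have [g gE] := extP (lin_comp f m).
(* [s] presents [N] as a quotient of [P * M], and [t] is the desired extension before descending to
   [N]. *)
have [|s sE] := @ex_linear _ (P * M)%type N (fun z => l z.1 + i1 z.2).
  by move=> a x y; rewrite /= !linearP scalerDr addrACA.
have [|t tE] := @ex_linear _ (P * M)%type B (fun z => g z.1 + f z.2).
  by move=> a x y; rewrite /= !linearP scalerDr addrACA.
have [||h hE] := @lin_factor _ _ _ _ s t.
- move=> n; have [p pE] := e_onto (e1 n).
  have /ie1x[y yE] : e1 (n - l p) = 0 by rewrite linearB lE pE subrr.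
  by exists (p, y); rewrite sE /= yE addrC subrK.
- move=> [p y]; rewrite sE tE /= => py0.
  have /iex[x xE] : e p = 0.
    by have /(congr1 e1) := py0; rewrite linearD linear0 lE (ses_comp _ ie1) addr0.
  rewrite -xE gE /= -linearD; suff -> : m x + y = 0 by rewrite linear0.
  by apply: i1_inj; rewrite linearD linear0 mE /= xE.
- exists h => y; have := hE (0, y).
  by rewrite sE tE /= !linear0 !add0r.
Qed.

(** A lift [l] on a free cover of [K] carries the kernel of the cover into [B]. Extending this
    restriction to the cover and subtracting it makes [l] descend to [K]. *)
Lemma ext1_lift K B E B' (j : {linear B -> E}) (q : {linear E -> B'}) (f : {linear K -> B'}) :
  ext1_zero K B -> ses j q -> exists g : {linear K -> E}, forall x, q (g x) = f x.
Proof.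
move=> extK jq; have [j_inj q_onto jqx] := jq.
have [e e_onto] := free_cover K.
have [l lE'] := projective_free (lin_comp f e) q_onto.
have lE x : q (l x) = f (e x) by exact: lE' x.
have [|m mE] := @lin_lift _ _ _ _ j (lin_comp l (smod_incl (lin_kernel e))) j_inj.
  by move=> x; apply/jqx; rewrite lE; have /= -> := smodP x; rewrite linear0.
have [h hE] := extK _ _ _ _ (ses_kernel e_onto) m.
have [|g gE] := @lin_factor _ _ _ _ e (l \- lin_comp j h) e_onto.
  by move=> x ex; have := hE (in_smod (S := lin_kernel e) ex);
    rewrite /= => ->; rewrite mE subrr.
exists g => x; have [y <-] := e_onto x.
by rewrite gE linearB lE /= (ses_comp _ jq) subr0.
Qed.

(** Both sides express [Ext^2(K, B) = 0]. *)
Lemma ext1_shift K' P K B E B' (i : {linear K' -> P}) (e : {linear P -> K})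
    (j : {linear B -> E}) (q : {linear E -> B'}) :
  ses i e -> ses j q -> projective P -> injective_module E ->
  ext1_zero K' B <-> ext1_zero K B'.
Proof.
move=> ie jq projP injE; have [i_inj e_onto iex] := ie.
have [j_inj q_onto jqx] := jq; split=> [extK'|extK].
  apply: (ext1_presentation ie projP) => f.
  have [g gE] := ext1_lift f extK' jq.
  have [h hE] := injE _ _ i g i_inj.
  by exists (lin_comp q h) => x; rewrite -gE -(hE x).
move=> M N i1 e1 ie1 f; have [i1_inj e1_onto ie1x] := ie1.
have [h hE'] := injE _ _ i1 (lin_comp j f) i1_inj.
have hE x : h (i1 x) = j (f x) by exact: hE' x.
have [|u uE] := @lin_factor _ _ _ _ e1 (lin_comp q h) e1_onto.
  by move=> y /ie1x[x <-]; rewrite /= hE (ses_comp _ jq).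
have [v vE] := extK _ _ _ _ ie u.
have [w wE'] := projP _ _ q v q_onto; have wE x : q (w x) = v x by exact: wE' x.
have [|g gE] := @lin_lift _ _ _ _ j (h \- lin_comp w (lin_comp i e1)) j_inj.
  by move=> y; apply/jqx; rewrite /= linearB wE vE uE subrr.
exists g => x; apply: j_inj.
by rewrite gE /= hE (ses_comp _ ie1) (linear0 i) linear0 subr0.
Qed.

(** A relation rather than a function, since an [n]-th syzygy [K] of [A] depends on the chosen
    resolution. The recursion peels off the step nearest to [K]. *)
Fixpoint syzygy (A : lmodType R) n K : Prop :=
  if n is m.+1 then exists K0 P (i : {linear K -> P}) (e : {linear P -> K0}),
    [/\ syzygy A m K0, projective P & ses i e]
  else K = A.

Fixpoint cosyzygy n B B' : Prop :=
  if n is m.+1 then exists B0 E (j : {linear B -> E}) (q : {linear E -> B0}),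
    [/\ cosyzygy m B0 B', injective_module E & ses j q]
  else B' = B.

(** Both sides express [Ext^(n+1)(A, B) = 0]. *)
Lemma ext1_dimension_shift n A K B B' :
  syzygy A n K -> cosyzygy n B B' -> ext1_zero K B <-> ext1_zero A B'.
Proof.
elim: n K B => [|n IHn] K B /=; first by move=> -> ->.
move=> [K0 [P [i [e [AK0 projP ie]]]]] [B0 [E [j [q [B0B' injE jq]]]]].
by rewrite (ext1_shift ie jq projP injE); apply: IHn.
Qed.

Lemma ext1_injective K E : injective_module E -> ext1_zero K E.
Proof.
by move=> injE M N i e [i_inj _ _] f; have [h hE] := injE _ _ i f i_inj; exists h.
Qed.

Lemma injective_zero B : (forall x : B, x = 0) -> injective_module B.
Proof.
move=> B0 M N m f _; have [|h hE] := @ex_linear _ N B (fun=> 0).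
  by move=> a x y; rewrite scaler0 addr0.
by exists h => x; rewrite (B0 (f x)) /= hE.
Qed.

Lemma cosyzygy_exists : enough_injectives R -> forall n B, exists B', cosyzygy n B B'.
Proof.
move=> enR; elim=> [|n IHn] B; first by exists B.
have [E [j [injE j_inj]]] := enR B.
have [B' BB'] := IHn (cokernel j); exists B'.
exists (cokernel j), E, j, (qproj (lin_image j)); split=> //; split=> //.
  exact: qproj_surj.
move=> x; rewrite -(linear0 (qproj _)); split=> [/qprojE|jx]; first by rewrite subr0.
by apply/qprojE; rewrite subr0.
Qed.

(** The cosyzygies are the images of the differentials, and that of [d n] lies in [J n.+1 = 0]. *)
Lemma finite_cosyzygy M : finite_injective_dimension M ->
  exists n B', cosyzygy n M B' /\ injective_module B'.
Proof.
move=> [J [e [d [n [injJ e_inj d_e d_d J0]]]]].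
pose B i := smod (lin_image (d i)).
have dB i : exists q : {linear J i -> B i}, forall x, val (q x) = d i x.
  have [|q qE] := @lin_lift R (J i) (B i) _ (smod_incl _) (d i) (@smod_incl_inj _ _ _).
    by move=> x; have dx : lin_image (d i) (d i x) by [exists x]; exists (in_smod dx).
  by exists q.
have dB_onto i (q : {linear J i -> B i}) : (forall x, val (q x) = d i x) -> onto q.
  by move=> qE y; have [x xE] := smodP y; exists x; apply: val_inj; rewrite qE.
have q0 i (q : {linear J i -> B i}) x : (forall x, val (q x) = d i x) ->
    q x = 0 <-> d i x = 0.
  by move=> qE; rewrite -qE; split=> [->|] //; exact: (@val_inj _ _ _ (q x) 0).
have cosB m : forall i, cosyzygy m (B i) (B (m + i)%N).
  elim: m => [|m IHm] i //=; have [q qE] := dB i.+1.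
  exists (B i.+1), (J i.+1), (smod_incl _), q; split=> //.
    by have := IHm i.+1; rewrite addnS.
  split; [exact: smod_incl_inj|exact: dB_onto|].
  move=> x; rewrite q0 //; have -> : (d i.+1 x = 0) = lin_kernel (d i.+1) x by [].
  rewrite d_d; split=> [dx|[y <-]]; first by exists (in_smod dx).
  exact: (smodP y).
(* [B 0] is already the first cosyzygy of [M], whence the shift. *)
exists n.+1, (B n); split; last first.
  apply: injective_zero => x; apply: val_inj; exact: (J0 n.+1).
have [q qE] := dB 0%N; exists (B 0%N), (J 0%N), e, q; split=> //.
  by have := cosB n 0%N; rewrite addn0.
split=> //; first exact: dB_onto.
by move=> x; rewrite q0 // -[_ = 0]/(lin_kernel (d 0%N) x) d_e.
Qed.
End Extensions.

(** * Noetherian rings and finitely generated modules *)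

Section Noetherian.
Context (R : pzRingType).
Implicit Types A M N : lmodType R.

Definition fg_submod M (S : submod M) := exists gs : seq M,
  (forall g, g \in gs -> S g) /\
  forall S' : submod M, (forall g, g \in gs -> S' g) -> forall x, S x -> S' x.

Definition noetherian M := forall S : submod M, fg_submod S.

(** If [S] is not finitely generated, [next] picks an element of [S] outside the span of each finite
    list in [S], and the spans form a chain that never stops. *)
Lemma noetherian_regular : left_noetherian R -> noetherian R^o.
Proof.
move=> accR S; apply: contrapT => nfgS.
pose span (gs : seq R^o) := submod_span [set g | g \in gs].
have /choice[next nextP] (gs : seq R^o) : exists x : R^o,
    (forall g, g \in gs -> S g) -> S x /\ ~ span gs x.
  have [gsS|] := pselect (forall g, g \in gs -> S g); last by exists 0.
  apply: contrapT => noX; apply: nfgS; exists gs; split=> // S' gsS' x Sx.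
  apply: contrapT => nS'x; apply: noX; exists x => _; split=> //.
  by move=> /(_ S' gsS').
pose gs n := iter n (fun gs => next gs :: gs) [::].
have gsS n g : g \in gs n -> S g.
  elim: n g => [|n IHn] g //=; rewrite inE => /predU1P[->|]; last exact: IHn.
  by have [] := nextP _ IHn.
have [|n nP] := accR (fun n => span (gs n)).
  by move=> n x /= xgs S' gsS'; apply: xgs => g g_gs; apply: gsS'; rewrite /= inE g_gs orbT.
have [_] := nextP (gs n) (gsS n); rewrite -(nP n.+1) // => -[].
by move=> S' gsS'; apply: gsS' => /=; rewrite inE eqxx.
Qed.

(** Generators of [S] are lifts of generators of its image in [N], together with generators of its
    trace on [A]. *)
Lemma noetherian_ses A M N (i : {linear A -> M}) (e : {linear M -> N}) :
  ses i e -> noetherian A -> noetherian N -> noetherian M.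
Proof.
move=> ie noeA noeN S; have [i_inj e_onto iex] := ie.
have T0 : exists s, S s /\ e s = 0 by exists 0; split; [exact: submod0|exact: linear0].
have TD u v : (exists s, S s /\ e s = u) -> (exists s, S s /\ e s = v) ->
    exists s, S s /\ e s = u + v.
  by move=> [s [Ss <-]] [t [St <-]]; exists (s + t); split; [exact: submodD|rewrite linearD].
have TZ a u : (exists s, S s /\ e s = u) -> exists s, S s /\ e s = a *: u.
  by move=> [s [Ss <-]]; exists (a *: s); split; [exact: submodZ|rewrite linearZ_LR].
have [gs [gsT gsP]] := noeN (Submod T0 TD TZ).
have U0 : S (i 0) by rewrite linear0; exact: submod0.
have UD u v : S (i u) -> S (i v) -> S (i (u + v)).
  by move=> Su Sv; rewrite linearD; exact: submodD.
have UZ a u : S (i u) -> S (i (a *: u)).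
  by move=> Su; rewrite linearZ_LR; exact: submodZ.
have [hs [hsU hsP]] := noeA (Submod (submod_set := fun x => S (i x)) U0 UD UZ).
have /choice[lift liftP] (g : N) : exists s, g \in gs -> S s /\ e s = g.
  have [/gsT[s Ss]|_] := boolP (g \in gs); first by exists s.
  by exists 0.
exists (map lift gs ++ map i hs); split=> [g|S' S'P x Sx].
  rewrite mem_cat => /orP[/mapP[h /liftP[Sh _] -> //]|/mapP[h h_hs ->]].
  exact: hsU.
(* The image of [S] intersected with [S'] contains the generators of the image of [S], so [x]
   differs from an element of this intersection by one coming from [A]. *)
have V0 : exists s, (S s /\ S' s) /\ e s = 0.
  by exists 0; split; [split; exact: submod0|exact: linear0].
have VD u v : (exists s, (S s /\ S' s) /\ e s = u) -> (exists s, (S s /\ S' s) /\ e s = v) ->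
    exists s, (S s /\ S' s) /\ e s = u + v.
  move=> [s [[Ss S's] <-]] [t [[St S't] <-]]; exists (s + t).
  by split; [split; exact: submodD|rewrite linearD].
have VZ a u : (exists s, (S s /\ S' s) /\ e s = u) -> exists s, (S s /\ S' s) /\ e s = a *: u.
  by move=> [s [[Ss S's] <-]]; exists (a *: s); split; [split; exact: submodZ|rewrite linearZ_LR].
have [||s [[Ss S's] sE]] := gsP (Submod V0 VD VZ) _ (e x).
- move=> g ggs; have [Sg gE] := liftP g ggs; exists (lift g); split=> //; split=> //.
  by apply: S'P; rewrite mem_cat map_f.
- by exists x.
have /iex[y yE] : e (x - s) = 0 by rewrite linearB sE subrr.
have W0 : S' (i 0) by rewrite linear0; exact: submod0.
have WD u v : S' (i u) -> S' (i v) -> S' (i (u + v)).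
  by move=> Su Sv; rewrite linearD; exact: submodD.
have WZ a u : S' (i u) -> S' (i (a *: u)).
  by move=> Su; rewrite linearZ_LR; exact: submodZ.
rewrite -(subrK s x) -yE; apply: submodD => //.
apply: (hsP (Submod (submod_set := fun x => S' (i x)) W0 WD WZ)).
  by move=> h h_hs; apply: S'P; rewrite mem_cat (map_f i) ?orbT.
rewrite /= yE -scaleN1r; apply: submodD => //; exact: submodZ.
Qed.

Lemma rV_universal M a (d : 'I_a -> M) : exists f : {linear 'rV[R]_a -> M},
  forall x, f x = \sum_j x 0 j *: d j.
Proof.
apply: ex_linear => r x y; rewrite scaler_sumr -big_split; apply: eq_bigr => j _ /=.
by rewrite !mxE scalerDl scalerA.
Qed.

Lemma rV_hom_expand M a (f : {linear 'rV[R]_a -> M}) x :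
  f x = \sum_j x 0 j *: f (delta_mx 0 j).
Proof.
by rewrite {1}[x]row_sum_delta linear_sum; apply: eq_bigr => j _; rewrite linearZ_LR.
Qed.

Lemma projective_rV a : projective 'rV[R]_a.
Proof.
move=> M N e f e_onto; have /choice[m mE] j := e_onto (f (delta_mx 0 j)).
have [h hE] := rV_universal m; exists h => x.
rewrite /= hE [RHS]rV_hom_expand linear_sum.
by apply: eq_bigr => j _; rewrite linearZ_LR mE.
Qed.

(** Induction on the rank: the first coordinate exhibits ['rV_(1 + a)] as an extension of [R] by
    ['rV_a]. *)
Lemma noetherian_rV a : left_noetherian R -> noetherian 'rV[R]_a.
Proof.
move=> noeR; elim: a => [|a IHa].
  by move=> S; exists [::]; split=> // S' _ x _; rewrite thinmx0; exact: submod0.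
have [|i iE] := @ex_linear R 'rV[R]_a 'rV[R]_(1 + a) (row_mx 0).
  by move=> r x y; rewrite scale_row_mx add_row_mx scaler0 addr0.
have [|e eE] := @ex_linear R 'rV[R]_(1 + a) R^o (fun x => x 0 0).
  by move=> r x y; rewrite !mxE.
apply: (@noetherian_ses _ _ _ i e) => //; last exact: noetherian_regular.
split.
- by move=> x y; rewrite !iE => /eq_row_mx[].
- by move=> r; exists (const_mx r); rewrite eE mxE.
- move=> x; rewrite eE; split=> [x0|[y <-]].
    exists (rsubmx x); rewrite iE -[RHS]hsubmxK; congr row_mx.
    apply/rowP => j; rewrite !mxE -[in LHS]x0 !ord1.
    by congr (x _ _); apply: val_inj.
  by rewrite iE mxE; case: splitP => // j _; rewrite mxE.
Qed.

Definition fg_module M := exists a (e : {linear 'rV[R]_a -> M}), onto e.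

Lemma fg_smod M (S : submod M) : fg_submod S -> fg_module (smod S).
Proof.
move=> [gs [gsS gsP]]; exists (size gs).
have [f fE] := rV_universal (fun j : 'I_(size gs) => gs`_j).
have fS x : S (f x).
  rewrite fE; apply: (big_ind (fun x => S x)); [exact: submod0|exact: submodD|].
  by move=> j _; apply/submodZ/gsS/mem_nth.
have [|g gE] := @lin_lift _ _ _ _ (smod_incl S) f (@smod_incl_inj _ _ S).
  by move=> x; exists (in_smod (fS x)).
exists g => y; have [|x xE] := gsP (lin_image f) _ _ (smodP y).
  move=> h /(nthP 0)[j lt_j <-]; exists (delta_mx 0 (Ordinal lt_j)).
  rewrite fE (bigD1 (Ordinal lt_j)) //= mxE !eqxx scale1r big1 ?addr0 // => l nl.
  by rewrite mxE (negbTE nl) andbF scale0r.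
by exists x; apply: val_inj; rewrite -xE -gE.
Qed.

Lemma fg_syzygy : left_noetherian R -> forall n M, fg_module M ->
  exists K, syzygy M n K /\ fg_module K.
Proof.
move=> noeR; elim=> [|n IHn] M fgM; first by exists M.
have [K [MK [a [e e_onto]]]] := IHn M fgM; exists (smod (lin_kernel e)); split.
  by exists K, 'rV[R]_a, (smod_incl _), e; split; [|exact: projective_rV|exact: ses_kernel].
exact/fg_smod/noetherian_rV.
Qed.
End Noetherian.

(** * Flat modules *)

Section Flatness.
Context (R : pzRingType).
Implicit Types K M P Q F : lmodType R.

(** Lazard's equational criterion; the relations [K] need not be finitely
    generated because it is only used over noetherian rings. *)
Definition flat M := forall a (f : {linear 'rV[R]_a -> M}) (K : submod 'rV[R]_a),
  (forall x, K x -> f x = 0) ->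
  exists c (u : {linear 'rV[R]_a -> 'rV[R]_c}) (v : {linear 'rV[R]_c -> M}),
    (forall x, K x -> u x = 0) /\ forall x, v (u x) = f x.

(** Flatness factors [f] through a finite free module on which [K] already dies, and a map out of
    that module lifts. *)
Lemma flat_lift F P (e : {linear P -> F}) a (f : {linear 'rV[R]_a -> F})
    (K : submod 'rV[R]_a) :
  flat F -> onto e -> (forall x, K x -> f x = 0) ->
  exists g : {linear 'rV[R]_a -> P},
    (forall x, K x -> g x = 0) /\ forall x, e (g x) = f x.
Proof.
move=> flatF e_onto fK; have [c [u [v [uK vu]]]] := flatF _ _ _ fK.
have [w wE] := projective_rV v e_onto.
exists (lin_comp w u); split=> x; first by move=> /uK /= ->; rewrite linear0.
exact: etrans (wE (u x)) (vu x).
Qed.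

(** Write [i f = v u] with [u] killing [K]. Then [e v] kills the image of [u], so flatness of [F]
    lifts it to [w] with [w u = 0]; now [v - w] lands in [F'] and factors [f] through [u]. *)
Lemma flat_kernel (F' : lmodType R) P F (i : {linear F' -> P}) (e : {linear P -> F}) :
  ses i e -> flat P -> flat F -> flat F'.
Proof.
move=> ie flatP flatF a f K fK; have [i_inj e_onto iex] := ie.
have [|c [u [v [uK vu]]]] := flatP _ (lin_comp i f) K.
  by move=> x /fK /= ->; rewrite linear0.
have [|w [wu ew]] := @flat_lift _ _ e _ (lin_comp e v) (lin_image u) flatF e_onto.
  by move=> _ [x <-] /=; rewrite vu /= (ses_comp _ ie).
have [|g gE] := @lin_lift _ _ _ _ i (v \- w) i_inj.
  by move=> x; apply/iex; rewrite /= linearB ew subrr.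
exists c, u, g; split=> // x; apply: i_inj.
by rewrite gE /= vu wu ?subr0 //; exists x.
Qed.

(** Over a right noetherian ring the solutions of a system of right linear
    equations are generated by finitely many of them, which solves the system
    coordinatewise; the support condition keeps the coefficients inside [M]. *)
Lemma flat_coordinates (T : Type) M (c : {linear M -> (T -> R^o)}) :
  left_noetherian R^c -> injective c ->
  (forall a (d : 'I_a -> M) (z : T -> R^o),
     (forall t, (forall j, c (d j) t = 0) -> z t = 0) -> exists m, c m = z) ->
  flat M.
Proof.
move=> noeR c_inj cP a f K fK.
(* The vectors annihilated by [K] form a right submodule, finitely generated since [R] is right
   noetherian; [Y] below is the matrix of its generators. *)
pose sol (y : 'rV[R^c]_a) := forall x, K x -> \sum_j (x 0 j : R) * (y 0 j : R) = 0.
have sol0 : sol 0 by move=> x _; rewrite big1 // => j _; rewrite mxE mulr0.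
have solD y z : sol y -> sol z -> sol (y + z).
  move=> ys zs x Kx; transitivity (\sum_j (x 0 j : R) * (y 0 j : R) +
      \sum_j (x 0 j : R) * (z 0 j : R)); last by rewrite ys // zs // addr0.
  by rewrite -big_split; apply: eq_bigr => j _; rewrite mxE; exact: (@mulrDr R).
have solZ b y : sol y -> sol (b *: y).
  move=> ys x Kx; transitivity ((\sum_j (x 0 j : R) * (y 0 j : R)) * (b : R)).
    by rewrite mulr_suml; apply: eq_bigr => j _; rewrite mxE; exact: (@mulrA R).
  by rewrite ys // mul0r.
have /fg_smod[n [gen gen_onto]] := noetherian_rV (a := a) noeR (Submod sol0 solD solZ).
pose Y j l : R := (val (gen (delta_mx 0 l)) : 'rV[R^c]_a) 0 j.
pose d j := f (delta_mx 0 j).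
(* Because [f] kills [K], the coordinates at [t] of the [d j] form a solution. *)
have solE t : exists z : 'I_n -> R, forall j, c (d j) t = \sum_l Y j l * z l.
  pose y : 'rV[R^c]_a := \row_j c (d j) t.
  have sy : sol y.
    move=> x Kx; have := fK x Kx; rewrite rV_hom_expand.
    move=> /(congr1 (fun m => c m t)); rewrite linear_sum fct_sumE linear0 => fx0.
    refine (etrans _ fx0).
    by apply: eq_bigr => j _; rewrite mxE linearZ_LR.
  have [z zE] := gen_onto (in_smod (S := Submod sol0 solD solZ) sy).
  exists (fun l => z 0 l) => j.
  have -> : c (d j) t = (val (gen z) : 'rV[R^c]_a) 0 j by rewrite zE /= mxE.
  rewrite rV_hom_expand -[val _]/(smod_incl _ _) linear_sum summxE.
  by apply: eq_bigr => l _; rewrite linearZ_LR mxE.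
(* Taking [z = 0] wherever all [d j] vanish makes the coefficient functions satisfy the support
   condition in [cP]. *)
have /choice[z zE] t : exists z : 'I_n -> R, (forall j, c (d j) t = \sum_l Y j l * z l) /\
    ((forall j, c (d j) t = 0) -> forall l, z l = 0).
  have [d0|nd0] := pselect (forall j, c (d j) t = 0); last by have [z] := solE t; exists z.
  exists (fun=> 0); split=> // j; rewrite d0 big1 // => l _; exact: mulr0.
have /choice[m mE] l : exists m, c m = (fun t => z t l).
  by apply: (cP a d) => t dt; have [_ ->] := zE t.
have [u uE] := @rV_universal R 'rV[R]_n a (fun j => \row_l Y j l).
have [v vE] := rV_universal m.
exists n, u, v; split=> x.
  move=> Kx; apply/rowP => l; rewrite uE summxE mxE.
  refine (etrans _ (smodP (gen (delta_mx 0 l)) x Kx)).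
  by apply: eq_bigr => j _; rewrite !mxE.
apply: c_inj; apply/funext => t.
rewrite vE (rV_hom_expand f) !linear_sum !fct_sumE.
have cE (r : R) h s : (r *: (h : T -> R^o)) s = r * (h s : R) by [].
under eq_bigr => l _ do rewrite linearZ_LR cE mE uE summxE mulr_suml.
under [RHS]eq_bigr => j _ do rewrite linearZ_LR cE.
rewrite exchange_big; apply: eq_bigr => j _ /=.
have [-> _] := zE t; rewrite mulr_sumr; apply: eq_bigr => l _.
by rewrite !mxE mulrA.
Qed.

(** The coefficients are supported in the union of the finite supports of the [d j]. *)
Lemma flat_free (S : choiceType) : left_noetherian R^c -> flat (freemod R S).
Proof.
move=> noeR; apply: (flat_coordinates (c := @fs_fun R R^o S)) => //.
move=> a d z dz; suff zf : fs_set (V := R^o) z.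
  by exists (in_smod (S := Submod (@fs0 _ _ _) (@fsD _ _ _) (@fsZ _ _ _)) zf).
have : finite_set (\bigcup_(j in [set: 'I_a]) [set s | fs_fun (d j) s != 0]).
  by apply: bigcup_finite => [|j _]; [exact: finite_finset|exact: fs_finite].
apply: sub_finite_set => s /= zs; apply: contrapT => ds; move/eqP: zs; apply.
apply: dz => j; apply/eqP/negPn/negP => djs; apply: ds; by exists j.
Qed.

(** * Projective dimension of flat modules *)

Section FlatDimension.
Hypotheses (lnoeR : left_noetherian R) (rnoeR : left_noetherian R^c).
Hypotheses (injR : finite_injective_dimension R^o) (enR : enough_injectives R).

(** The kernel of [e] is finitely generated, so a map from it to a free module meets finitely many
    coordinates [D]. Each of these extends by [ext1_zero K R^o], and the extensions are summed. *)
Lemma ext1_free K (S : choiceType) : fg_module K -> ext1_zero K R^o ->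
  ext1_zero K (freemod R S).
Proof.
move=> [a [e e_onto]] extK.
apply: (ext1_presentation (ses_kernel e_onto)); first exact: projective_rV.
move=> f; have [n [gen gen_onto]] := fg_smod (noetherian_rV lnoeR (lin_kernel e)).
pose D := \bigcup_(l in [set: 'I_n]) [set s | fs_fun (f (gen (delta_mx 0 l))) s != 0].
have finD : finite_set D.
  by apply: bigcup_finite => [|l _]; [exact: finite_finset|exact: fs_finite].
have fD x : [set s | fs_fun (f x) s != 0] `<=` D.
  move=> s /=; have [z <-] := gen_onto x => fs; apply: contrapT => nDs.
  move/eqP: fs; apply; rewrite -[f _]/(lin_comp f gen z) rV_hom_expand linear_sum fct_sumE.
  rewrite big1 // => l _; have [fs|fs] := eqVneq (fs_fun (f (gen (delta_mx 0 l))) s) 0.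
    exact: etrans (congr1 (fun r => z 0 l * r) fs) (mulr0 _).
  by case: nDs; exists l.
have coordP s : exists h : {linear smod (lin_kernel e) -> R^o}, forall x, h x = fs_fun (f x) s.
  by apply: ex_linear => r x y; rewrite linearP fs_funP.
have /choice[g gE] s : exists g : {linear 'rV[R]_a -> R^o},
    forall x, g (smod_incl _ x) = fs_fun (f x) s.
  have [h hE] := coordP s; have [g gE] := extK _ _ _ _ (ses_kernel e_onto) h.
  by exists g => x; rewrite gE hE.
have [|G GE] := @ex_linear R 'rV[R]_a (freemod R S)
    (fun x => \sum_(s <- fset_set D) fs_single s (g s x)).
  move=> r x y; rewrite scaler_sumr -big_split; apply: eq_bigr => s _ /=.
  by rewrite -linearP -linearP.
exists G => x; rewrite GE [RHS](fs_expand finD (fD x)).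
by apply: eq_bigr => s _; rewrite gE.
Qed.

(** Extend [i f] to [g] with values in the free module. As [e g] kills [ker q] and [Q] is flat, it
    lifts to [h] killing [ker q]; the difference [g - h] lands in [F] and extends [f]. *)
Lemma ext1_flat_kernel K F Q (S : choiceType) (i : {linear F -> freemod R S})
    (e : {linear freemod R S -> Q}) :
  ses i e -> flat Q -> fg_module K -> ext1_zero K R^o -> ext1_zero K F.
Proof.
move=> ie flatQ fgK extK; have [i_inj e_onto iex] := ie.
have extF := @ext1_free K S fgK extK.
have [a [q q_onto]] := fgK.
apply: (ext1_presentation (ses_kernel q_onto)); first exact: projective_rV.
move=> f; have [g gE] := extF _ _ _ _ (ses_kernel q_onto) (lin_comp i f).
have [|h [h0 hE]] := @flat_lift _ _ e _ (lin_comp e g) (lin_kernel q) flatQ e_onto.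
  by move=> x qx; have /= -> := gE (in_smod qx); rewrite (ses_comp _ ie).
have [|d dE] := @lin_lift _ _ _ _ i (g \- h) i_inj.
  by move=> x; apply/iex; rewrite /= linearB hE subrr.
exists d => x; apply: i_inj; rewrite dE /= h0 ?subr0; last exact: (smodP x).
exact: gE.
Qed.

Lemma flat_syzygy n (D : lmodType R) : flat D -> exists K, syzygy D n K /\ flat K.
Proof.
elim: n => [|n IHn] flatD; first by exists D.
have [K [DK flatK]] := IHn flatD; have [e e_onto] := free_cover K.
have ie := ses_kernel e_onto; exists (smod (lin_kernel e)); split.
  by exists K, (freemod R K), (smod_incl _), e; split => //; exact: projective_free.
by apply: flat_kernel ie _ flatK; apply: flat_free.
Qed.

Lemma fpd_syzygy n (D : lmodType R) K : syzygy D n K -> finite_projective_dimension K ->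
  finite_projective_dimension D.
Proof.
elim: n K => [|n IHn] K /=; first by move=> ->.
move=> [K0 [P [i [e [DK0 projP ie]]]]] fpdK; apply: IHn DK0 _.
exact: fpd_ses ie projP fpdK.
Qed.

Lemma flat_fpd (D : lmodType R) : flat D -> finite_projective_dimension D.
Proof.
move=> flatD; have [n [B [RB injB]]] := finite_cosyzygy injR.
have [K [DK flatK]] := flat_syzygy n flatD.
apply: (fpd_syzygy DK); apply: fpd_projective.
have [e e_onto] := free_cover K; have ie := ses_kernel e_onto.
set F := smod (lin_kernel e) in ie *.
(* [K] and [F] are the syzygies [D_n] and [D_(n+1)]; by the choice of [E], [Ext^1(-, E)] is
   [Ext^(n+1)(-, F)]. *)
have [E FE] := cosyzygy_exists enR n F.
have injE : injective_module E.
  (* The condition [Ext^1(R/J, E) = 0] shifts to [Ext^1(A, F) = 0] for a finitely generated [n]-th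
     syzygy [A] of [R/J]. *)
  apply: Baer => J; suff extJ : ext1_zero (qmod J) E by apply: extJ; exact: ses_quotient.
  have [|A [JA fgA]] := fg_syzygy lnoeR n (M := qmod J).
    have [|q qE] := @ex_linear R 'rV[R]_1 (qmod J) (fun x => qproj J (x 0 0)).
      by move=> r x y; rewrite !mxE -linearP.
    exists 1%N, q => y; have [r <-] := qproj_surj y.
    by exists (const_mx r); rewrite qE mxE.
  apply/(ext1_dimension_shift JA FE); apply: ext1_flat_kernel ie flatK fgA _ => //.
  by apply/(ext1_dimension_shift JA RB); apply: ext1_injective.
have extK : ext1_zero K F.
  by apply/(ext1_dimension_shift DK FE); apply: ext1_injective.
(* The cover of [K] splits, so [K] is a summand of a free module. *)
have [r rE] := extK _ _ _ _ ie idfun.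
have [|s sE] := @lin_factor _ _ _ _ e (idfun \- lin_comp (smod_incl _) r) e_onto.
  by move=> x ex; have /= -> := rE (in_smod (S := lin_kernel e) ex); rewrite subrr.
apply: (projective_retract (a := s) (b := e)); last exact: projective_free.
move=> y; have [x <-] := e_onto y; rewrite sE /= linearB.
by have /= -> := smodP (r x); rewrite subr0.
Qed.
End FlatDimension.
End Flatness.

(** * Smooth representations *)

Section SmoothConstructions.
Context (k : fieldType) (G : topologicalGroupType).
Implicit Types U V W : smooth_rep k G.

Lemma ex_rep_hom V W (f : V -> W) :
  linear f -> (forall g v, f (act g v) = act g (f v)) -> exists h : rep_hom V W, h =1 f.
Proof.
move=> /ex_linear[h hE] fG.
have hG g v : h (act g v) = act g (h v) by rewrite !hE fG.
by exists (RepHom hG).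
Qed.

Lemma nbhs1_stab V (v : V) : nbhs (1%g : G) [set g | act g v = v].
Proof. by apply: open_nbhs_nbhs; split; [exact: act_smooth|exact: act1]. Qed.

Section Kernel.
Context (V W : smooth_rep k G) (q : rep_hom V W).
Notation K := (smod (lin_kernel q)).

Fact ker_act_subproof g (v : K) : lin_kernel q (act g (val v)).
Proof. by rewrite /= rep_equiv; have /= -> := smodP v; rewrite linear0. Qed.
Definition ker_act g (v : K) : K := in_smod (ker_act_subproof g v).
Fact ker_act_linear g : linear (ker_act g).
Proof. by move=> a u v; apply: val_inj; rewrite /= linearP. Qed.
HB.instance Definition _ g :=
  GRing.isLinear.Build k K K _ (ker_act g) (ker_act_linear g).
Fact ker_act1 v : ker_act 1%g v = v.
Proof. by apply: val_inj; rewrite /= act1. Qed.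
Fact ker_actM g h v : ker_act (g * h)%g v = ker_act g (ker_act h v).
Proof. by apply: val_inj; rewrite /= actM. Qed.
Fact ker_smooth v : open [set g | ker_act g v = v].
Proof.
have -> : [set g | ker_act g v = v] = [set g | act g (val v) = val v].
  by apply/seteqP; split=> g /= gv; [rewrite -[in RHS]gv|apply: val_inj].
exact: act_smooth.
Qed.
Definition ker_rep : smooth_rep k G := @SmoothRep k G K ker_act ker_act1 ker_actM ker_smooth.

Definition ker_incl : rep_hom ker_rep V :=
  @RepHom k G ker_rep V (smod_incl (lin_kernel q)) (fun _ _ => erefl).

Lemma ker_lift U (f : rep_hom U V) : (forall u, q (f u) = 0) ->
  exists h : rep_hom U ker_rep, rep_comp ker_incl h = f.
Proof.
move=> qf; have [|g v|h hE] := @ex_rep_hom U ker_rep (fun u => in_smod (S := lin_kernel q) (qf u)).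
- by move=> a u v; apply: val_inj; rewrite /= linearP.
- by apply: val_inj; rewrite /= rep_equiv.
- by exists h; apply: rep_ext => u; rewrite /= hE.
Qed.
End Kernel.

Section Pair.
Context (V W : smooth_rep k G).
Definition pair_act g (z : V * W) : V * W := (act g z.1, act g z.2).
Fact pair_act_linear g : linear (pair_act g).
Proof. by move=> a u v; congr pair; rewrite /= linearP. Qed.
HB.instance Definition _ g :=
  GRing.isLinear.Build k (V * W)%type (V * W)%type _ (pair_act g) (pair_act_linear g).
Fact pair_act1 z : pair_act 1%g z = z.
Proof. by case: z => v w; rewrite /pair_act !act1. Qed.
Fact pair_actM g h z : pair_act (g * h)%g z = pair_act g (pair_act h z).
Proof. by rewrite /pair_act !actM. Qed.
Fact pair_smooth z : open [set g | pair_act g z = z].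
Proof.
case: z => v w.
have -> : [set g | pair_act g (v, w) = (v, w)] = [set g | act g v = v] `&` [set g | act g w = w].
  by apply/seteqP; split=> g /= => [[-> ->]|[gv gw]] //; rewrite /pair_act gv gw.
by apply: openI; apply: act_smooth.
Qed.
Definition pair_rep : smooth_rep k G :=
  @SmoothRep k G (V * W)%type pair_act pair_act1 pair_actM pair_smooth.
End Pair.

Section FiniteSupportRep.
Context (V : smooth_rep k G) (S : choiceType).
Notation fsV := (fsupp V S).

Fact fs_act_subproof g (u : fsV) : fs_set (fun s => act g (fs_fun u s)).
Proof.
apply: (sub_finite_set _ (fs_finite u)) => s /=; apply: contraNN => /eqP ->.
by rewrite linear0.
Qed.
Definition fs_act g (u : fsV) : fsV :=
  in_smod (S := Submod (@fs0 _ _ _) (@fsD _ _ _) (@fsZ _ _ _)) (fs_act_subproof g u).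
Lemma fs_actE g u s : fs_fun (fs_act g u) s = act g (fs_fun u s). Proof. by []. Qed.
Fact fs_act_linear g : linear (fs_act g).
Proof. by move=> a u v; apply: fs_ext => s; rewrite fs_funP !fs_actE fs_funP linearP. Qed.
HB.instance Definition _ g :=
  GRing.isLinear.Build k fsV fsV _ (fs_act g) (fs_act_linear g).
Fact fs_act1 u : fs_act 1%g u = u.
Proof. by apply: fs_ext => s; rewrite fs_actE act1. Qed.
Fact fs_actM g h u : fs_act (g * h)%g u = fs_act g (fs_act h u).
Proof. by apply: fs_ext => s; rewrite !fs_actE actM. Qed.
Fact fs_smooth u : open [set g | fs_act g u = u].
Proof.
apply: open_stabilizer; [exact: fs_act1|exact: fs_actM|].
have /finite_fsetP[D DE] := fs_finite u.
have : nbhs (1%g : G) (\bigcap_(s in [set` D]) [set g | act g (fs_fun u s) = fs_fun u s]).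
  by apply: filter_bigI => s _; exact: nbhs1_stab.
apply: filterS => g gD /=; apply: fs_ext => s; rewrite fs_actE.
have [->|us] := eqVneq (fs_fun u s) 0; first by rewrite linear0.
by apply: gD; rewrite -DE.
Qed.
Definition fs_rep : smooth_rep k G :=
  @SmoothRep k G fsV fs_act fs_act1 fs_actM fs_smooth.

Fact fs_single_equiv s g v : fs_single s (act g v) = fs_act g (fs_single s v).
Proof.
by apply: fs_ext => t; rewrite fs_actE !fs_singleE; case: eqP; rewrite ?linear0.
Qed.
Definition fs_single_rep (s : S) : rep_hom V fs_rep :=
  @RepHom k G V fs_rep (fs_single s : {linear V -> fsV}) (fs_single_equiv s).

Definition fs_eval s (u : fsV) : V := fs_fun u s.
Fact fs_eval_linear s : linear (fs_eval s). Proof. by []. Qed.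
HB.instance Definition _ s :=
  GRing.isLinear.Build k fsV V _ (fs_eval s) (fs_eval_linear s).
Definition fs_eval_rep (s : S) : rep_hom fs_rep V :=
  @RepHom k G fs_rep V (fs_eval s : {linear fsV -> V}) (fun _ _ => erefl).
End FiniteSupportRep.

(** Products in the category of smooth representations: the smooth vectors of
    the set-theoretic product. *)
Section SmoothProduct.
Context (T : Type) (V : smooth_rep k G).

Definition smooth_family (u : T -> V) : Prop :=
  nbhs (1%g : G) [set g | forall t, act g (u t) = u t].
Fact smooth_family0 : smooth_family 0.
Proof. by rewrite /smooth_family; move: (nbhs1_stab (0 : V)); apply: filterS => g /= g0 t. Qed.
Fact smooth_familyD u v : smooth_family u -> smooth_family v -> smooth_family (u + v).
Proof.
rewrite /smooth_family => su sv; have : nbhs (1%g : G) ([set g | forall t, act g (u t) = u t] `&`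
    [set g | forall t, act g (v t) = v t]) by apply: filterI.
apply: filterS => g /= [gu gv] t.
by transitivity (act g (u t + v t)) => //; rewrite linearD gu gv.
Qed.
Fact smooth_familyZ a u : smooth_family u -> smooth_family (a *: u).
Proof.
rewrite /smooth_family; apply: filterS => g /= gu t.
by transitivity (act g (a *: u t)) => //; rewrite linearZ_LR gu.
Qed.
Definition smooth_submod : submod (T -> V) :=
  Submod smooth_family0 smooth_familyD smooth_familyZ.
Notation prodV := (smod smooth_submod).

Fact prod_act_subproof g (u : prodV) : smooth_family (fun t => act g (val u t)).
Proof.
(* Acting by [g] conjugates stabilizers, and conjugation is continuous. *)
have cont : continuous (fun h : G => g^-1 * h * g)%g.
  move=> h; apply: (@continuous_comp _ _ _ (fun h => g^-1 * h)%g (fun h => h * g)%g).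
    exact: continuous_mull.
  exact: continuous_mulr.
have : (g^-1 * h * g)%g @[h --> (1%g : G)] --> (g^-1 * 1 * g)%g by exact: cont.
rewrite mulg1 mulVg => /(_ _ (smodP u)) gu.
have {gu} : nbhs (1%g : G) [set h | forall t, act (g^-1 * h * g)%g (val u t) = val u t] by [].
rewrite /smooth_family; apply: filterS => h /= hu t.
by rewrite -actM -[(h * g)%g](mulVKg g) !mulgA actM -actM -!mulgA actM mulgA hu.
Qed.
Definition prod_act g (u : prodV) : prodV :=
  in_smod (S := smooth_submod) (prod_act_subproof g u).
Fact prod_act_linear g : linear (prod_act g).
Proof. by move=> a u v; apply/val_inj/funext => t; rewrite /= linearP. Qed.
HB.instance Definition _ g :=
  GRing.isLinear.Build k prodV prodV _ (prod_act g) (prod_act_linear g).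
Fact prod_act1 u : prod_act 1%g u = u.
Proof. by apply/val_inj/funext => t; rewrite /= act1. Qed.
Fact prod_actM g h u : prod_act (g * h)%g u = prod_act g (prod_act h u).
Proof. by apply/val_inj/funext => t; rewrite /= actM. Qed.
Fact prod_smooth u : open [set g | prod_act g u = u].
Proof.
apply: open_stabilizer; [exact: prod_act1|exact: prod_actM|].
by move: (smodP u); apply: filterS => g gu; apply/val_inj/funext => t; exact: gu.
Qed.
Definition prod_rep : smooth_rep k G :=
  @SmoothRep k G prodV prod_act prod_act1 prod_actM prod_smooth.

Definition prod_eval t (u : prodV) : V := val u t.
Fact prod_eval_linear t : linear (prod_eval t). Proof. by []. Qed.
HB.instance Definition _ t :=
  GRing.isLinear.Build k prodV V _ (prod_eval t) (prod_eval_linear t).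
Definition prod_eval_rep (t : T) : rep_hom prod_rep V :=
  @RepHom k G prod_rep V (prod_eval t : {linear prodV -> V}) (fun _ _ => erefl).
End SmoothProduct.

(** The complement is the kernel of [b]. *)
Lemma direct_summand_retract V W (a : rep_hom V W) (b : rep_hom W V) :
  (forall v, b (a v) = v) -> direct_summand V W.
Proof.
move=> ab; exists (ker_rep b), a, (ker_incl b).
have bw w : lin_kernel b (w - a (b w)) by rewrite /= linearB ab subrr.
exists (fun w => (b w, in_smod (bw w))) => [[v x]|w] /=; last by rewrite addrC subrK.
have bx : b (val x) = 0 := smodP x.
have bE : b (a v + val x) = v by rewrite linearD ab bx addr0.
congr (_, _) => //; apply: val_inj; rewrite /= bE addrC addKr //.
Qed.

Lemma retract_direct_summand V W : direct_summand V W ->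
  exists (a : rep_hom V W) (b : rep_hom W V), forall v, b (a v) = v.
Proof.
move=> [V' [i [j [c cK Kc]]]]; have cE w : i (c w).1 + j (c w).2 = w by exact: Kc.
have cU w z : w = i z.1 + j z.2 -> c w = z by move=> ->; exact: cK.
have [||b bE] := @ex_rep_hom W V (fun w => (c w).1).
- move=> a u v; rewrite (cU (a *: u + v) (a *: c u + c v)) //=.
  by rewrite !linearP /= addrACA -scalerDr !cE.
- move=> g w; rewrite (cU (act g w) (act g (c w).1, act g (c w).2)) //=.
  by rewrite !rep_equiv -linearD cE.
exists i, b => v; rewrite bE (cU _ (v, 0)) //=.
by rewrite linear0 addr0.
Qed.
End SmoothConstructions.

(** * Direct sums of copies of [X] and their invariants *)

Section UniversalRep.
Context (k : fieldType) (p : nat) (G : topologicalGroupType).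
Context (I : open_pro_p_subgroup p G).
Implicit Types (U V W : smooth_rep k G) (S : choiceType).

Notation X := (ind_rep k I).
Notation H := (hecke k I).
Notation inv V := (invariants I V).

Lemma frobZ V (h : H) (v : inv V) : frob (h *: v) = rep_comp (frob v) (h : rep_end X).
Proof. exact: frob_hecke_act. Qed.

Lemma frob_inj V (v w : inv V) : frob v = frob w -> v = w.
Proof. by move=> vw; apply: inv_ext; rewrite -!frob_indicator vw. Qed.

Lemma inv_mapE V W (f : rep_hom V W) (v : inv V) : inv_val (inv_map I f v) = f (inv_val v).
Proof. by []. Qed.

Lemma inv_val0 V : inv_val (0 : inv V) = 0. Proof. by []. Qed.

Lemma ex_inv V (v : V) : (forall i, (I : set G) i -> act i v = v) ->
  exists w : inv V, inv_val w = v.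
Proof. by move=> vI; exists (in_smod (S := inv_submod I V) vI). Qed.

(** [F] of the free [H]-module on [S], see [I_projective_XS]. *)
Definition XS S : smooth_rep k G := fs_rep X S.

Lemma XS_hom_ext S V (f g : rep_hom (XS S) V) :
  (forall s, f (fs_single s (indicator k I)) = g (fs_single s (indicator k I))) -> f = g.
Proof.
move=> fg; apply: rep_ext; apply: fs_hom_ext => s x.
have: rep_comp f (fs_single_rep X s) = rep_comp g (fs_single_rep X s).
  exact/ind_hom_ext/fg.
by move/(congr1 (fun h : rep_hom X V => h x)).
Qed.

Lemma XS_universal S V (b : S -> inv V) :
  exists f : rep_hom (XS S) V, forall s x, f (fs_single s x) = frob (b s) x.
Proof.
have [f fE] := fs_universal (fun s => frob (b s) : {linear X -> V}).
have fG g (u : XS S) : f (act g u) = act g (f u).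
  have fgE : f \o (act g : {linear XS S -> XS S}) =1 (act g : {linear V -> V}) \o f.
    apply: fs_hom_ext => s x; rewrite /= fE -rep_equiv -fE; congr (f _).
    exact/esym/(rep_equiv (fs_single_rep X s)).
  exact: fgE u.
by exists (RepHom fG).
Qed.

Fact XS_gen_subproof S (s : S) i : (I : set G) i ->
  act i (fs_single s (indicator k I) : XS S) = fs_single s (indicator k I).
Proof.
move=> Ii; rewrite -[LHS](rep_equiv (fs_single_rep X s)) /=.
by rewrite -[in RHS](indicator_fixed k Ii).
Qed.
Definition XS_gen S (s : S) : inv (XS S) :=
  in_smod (S := inv_submod I (XS S)) (XS_gen_subproof s).

Lemma frob_XS_gen S (s : S) x : frob (XS_gen s) x = fs_single s x.
Proof.
have : frob (XS_gen s) = fs_single_rep X s by apply: ind_hom_ext; rewrite frob_indicator.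
by move/(congr1 (fun h : rep_hom X (XS S) => h x)).
Qed.

Lemma inv_X_regular : exists c : {linear inv X -> H^o}, forall v, c v = frob v :> rep_end X.
Proof.
have [|c cE] := @ex_linear H (inv X) H^o (fun v => frob v : rep_end X).
  by move=> h v w; rewrite frobD frobZ.
by exists c => v; rewrite cE.
Qed.

Lemma XS_coord S (s : S) : exists c : {linear inv (XS S) -> H^o},
  forall w, c w = frob (inv_map I (fs_eval_rep X s) w) :> rep_end X.
Proof.
have [c cE] := inv_X_regular.
by exists (lin_comp c (inv_map I (fs_eval_rep X s))) => w; rewrite /= cE.
Qed.

(** Invariants commute with direct sums, and [X^I = End_G(X)] is [H] by Frobenius reciprocity; the
    inverse reads off coordinates. *)
Lemma inv_XS_free S : exists t : {linear freemod H S -> inv (XS S)},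
  bijective t /\ forall s, t (free_gen H s) = XS_gen s.
Proof.
have [t tE] := free_universal (R := H) (@XS_gen S); exists t; split=> //.
have /choice[c cE] := @XS_coord S.
have c0 w s : c s w = 0 <-> fs_fun (inv_val w) s = 0.
  rewrite cE; split=> [c0|ws].
    have := frob_indicator (inv_map I (fs_eval_rep X s) w).
    by rewrite c0 => wE; exact: (esym wE).
  by apply: ind_hom_ext; rewrite frob_indicator.
have cf w : fs_set (V := H^o) (fun s => c s w).
  apply: (sub_finite_set _ (fs_finite (inv_val w))) => s /=.
  by apply: contraNN => /eqP/c0 ->.
have [|d dE] := @ex_linear H (inv (XS S)) (freemod H S)
    (fun w => in_smod (S := Submod (@fs0 _ _ _) (@fsD _ _ _) (@fsZ _ _ _)) (cf w)).
  by move=> h v w; apply: fs_ext => s; rewrite fs_funP /fs_fun /= linearP.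
have dcE w s : fs_fun (d w) s = c s w by rewrite dE.
have dt : cancel t d.
  have dtE : lin_comp d t =1 idfun.
    apply: free_hom_ext => s /=; apply: fs_ext => r.
    rewrite dcE tE cE fs_singleE; case: (r =P s) => [->|rs]; apply: ind_hom_ext;
      rewrite frob_indicator.
      by transitivity (if s == s then indicator k I else 0); last by rewrite eqxx.
    by transitivity (if r == s then indicator k I else 0); last by case: eqP.
  exact: dtE.
have d_inj : injective d.
  apply: lin_inj0 => w dw; apply: inv_ext; apply: fs_ext => s; rewrite inv_val0.
  by apply/c0; rewrite -dcE dw.
by exists d => // w; apply: d_inj; rewrite dt.
Qed.

Lemma projective_inv_XS S : projective (inv (XS S)).
Proof.
have [t [[d dt td] _]] := inv_XS_free S.
have [|d' d'E] := @ex_linear H (inv (XS S)) (freemod H S) d.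
  by move=> h v w; apply: (can_inj dt); rewrite td linearP !td.
apply: (projective_retract (a := d') (b := t)); last exact: projective_free.
by move=> x; rewrite d'E td.
Qed.

(** By Frobenius reciprocity it suffices to lift the invariant vectors [f (XS_gen s)]. *)
Lemma XS_lift S V W (q : rep_hom V W) (f : rep_hom (XS S) W) :
  onto (inv_map I q) -> exists g : rep_hom (XS S) V, rep_comp q g = f.
Proof.
move=> q_onto; have /choice[b bE] s := q_onto (inv_map I f (XS_gen s)).
have [g gE] := XS_universal b; exists g; apply: XS_hom_ext => s.
by rewrite /= gE frob_indicator -inv_mapE bE.
Qed.

Lemma fpd_kernel_iso (R : pzRingType) (K M N : lmodType R) (i : {linear K -> M})
    (e : {linear M -> N}) :
  injective i -> (forall x, e x = 0 <-> exists y, i y = x) ->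
  finite_projective_dimension (smod (lin_kernel e)) <-> finite_projective_dimension K.
Proof.
move=> i_inj ie.
have [|a aE] := @lin_lift _ _ _ _ i (smod_incl (lin_kernel e)) i_inj.
  by move=> x; apply/ie; exact: (smodP x).
have ei x : lin_kernel e (i x) by apply/ie; exists x.
have [|b bE] := @lin_lift _ _ _ _ (smod_incl (lin_kernel e)) i (@smod_incl_inj _ _ _).
  by move=> x; exists (in_smod (ei x)).
have ab : cancel a b by move=> x; apply: (@smod_incl_inj _ _ (lin_kernel e)); rewrite bE aE.
have ba : cancel b a by move=> x; apply: i_inj; rewrite aE bE.
split; first by apply: (fpd_iso (a := a)); exists b.
by apply: (fpd_iso (a := b)); exists a.
Qed.

(** Left exactness of [U]. *)
Lemma inv_ker V W (q : rep_hom V W) :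
  injective (inv_map I (ker_incl q)) /\
  forall v, inv_map I q v = 0 <-> exists w, inv_map I (ker_incl q) w = v.
Proof.
split=> [v w vw|v].
  by apply: inv_ext; apply: val_inj; exact: (congr1 (@inv_val _ _ _ _ _) vw).
split=> [qv|[w <-]]; last first.
  by apply: inv_ext; rewrite inv_mapE; exact: (smodP (inv_val w)).
have kv : lin_kernel q (inv_val v) by rewrite /= -inv_mapE qv.
have [|w wE] := @ex_inv (ker_rep q) (in_smod kv).
  by move=> i Ii; apply: val_inj; exact: inv_valP.
by exists w; apply: inv_ext; rewrite inv_mapE wE.
Qed.

Lemma fpd_inv_ker V W (q : rep_hom V W) :
  finite_projective_dimension (smod (lin_kernel (inv_map I q))) <->
  finite_projective_dimension (inv (ker_rep q)).
Proof. by have [inj ker] := inv_ker q; exact: (fpd_kernel_iso inj ker). Qed.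

(** A free cover [e] of [V^I] is [U f] up to the isomorphism [t], where [f] is given by the images
    of the generators. Thus [f] is a trivial fibration. *)
Lemma XS_cover V : finite_projective_dimension (inv V) ->
  exists S (f : rep_hom (XS S) V), onto (inv_map I f) /\
    finite_projective_dimension (smod (lin_kernel (inv_map I f))).
Proof.
move=> /fpd_free_cover[S [e [e_onto fpdK]]]; exists S.
have [f fE] := XS_universal (fun s => e (free_gen H s)); exists f.
have [t [[d dt td] tE]] := inv_XS_free S.
have ft : lin_comp (inv_map I f) t =1 e.
  apply: free_hom_ext => s; rewrite /= tE; apply: inv_ext.
  by rewrite inv_mapE fE frob_indicator.
split; first by move=> v; have [u <-] := e_onto v; exists (t u); rewrite -ft.
apply/(@fpd_kernel_iso _ _ _ _ (lin_comp t (smod_incl (lin_kernel e)))) => //.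
  by move=> x y /(can_inj dt)/smod_incl_inj.
move=> w; split=> [fw|[u <-]].
  have eu : lin_kernel e (d w) by rewrite /= -ft /= td.
  by exists (in_smod eu) => /=; rewrite td.
by have := ft (smod_incl _ u); rewrite /= => ->; exact: (smodP u).
Qed.
End UniversalRep.

Section FreeVectorSpace.
Context (k : fieldType) (S : choiceType).

(* [free_mod] has the same elements as [freemod k], but not the same structure. *)
Let to_fsupp (u : free_mod k S) : freemod k S :=
  in_smod (S := Submod (@fs0 _ k^o S) (@fsD _ _ _) (@fsZ _ _ _)) (smodP u).
Let of_fsupp (u : freemod k S) : free_mod k S :=
  in_smod (S := free_submod k S) (smodP u).

Let to_delta s : to_fsupp (free_delta s) = free_gen k s.
Proof. by apply: fs_ext => t; rewrite fs_singleE -mulrb. Qed.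

Lemma free_mod_universal (B : lmodType k) (b : S -> B) :
  exists f : {linear free_mod k S -> B}, forall s, f (free_delta s) = b s.
Proof.
have [f fE] := free_universal (R := k) b.
have [|g gE] := @ex_linear k (free_mod k S) B (fun u => f (to_fsupp u)).
  by move=> a u v; rewrite -linearP; congr (f _); apply: fs_ext.
by exists g => s; rewrite gE to_delta fE.
Qed.

Lemma free_mod_hom_ext (B : lmodType k) (f g : {linear free_mod k S -> B}) :
  (forall s, f (free_delta s) = g (free_delta s)) -> f =1 g.
Proof.
have [|h hE] := @ex_linear k (freemod k S) (free_mod k S) of_fsupp.
  by move=> a u v; apply: free_ext.
have hgen s : h (free_gen k s) = free_delta s.
  by rewrite hE; apply: free_ext => t; rewrite free_deltaE -to_delta.
move=> fg u; have -> : u = h (to_fsupp u) by rewrite hE; apply: free_ext.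
apply: (@free_hom_ext k S B (lin_comp f h) (lin_comp g h)) => s /=.
by rewrite hgen.
Qed.
End FreeVectorSpace.

(** * The adjunction between [F] and [U] *)

Section TensorUniversal.
Context (k : fieldType) (p : nat) (G : topologicalGroupType).
Context (I : open_pro_p_subgroup p G).

Notation X := (ind_rep k I).
Notation H := (hecke k I).
Notation inv V := (invariants I V).

Section Module.
Context (M : lmodType H).
Notation pi := (qproj (submod_span (@tensor_relations k p G I M))).

Lemma qproj_relation r : tensor_relations r -> pi r = 0.
Proof.
move=> rR; rewrite -(linear0 pi); apply/qprojE; rewrite subr0.
by move=> S; apply.
Qed.

Lemma tensDl (x y : X) (m : M) : tens (x + y) m = tens x m + tens y m.
Proof.
apply/eqP; rewrite -subr_eq0 opprD addrA /tens -!linearB; apply/eqP/qproj_relation.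
by left; exists x, y, m.
Qed.

Lemma tensDr (x : X) (m n : M) : tens x (m + n) = tens x m + tens x n.
Proof.
apply/eqP; rewrite -subr_eq0 opprD addrA /tens -!linearB; apply/eqP/qproj_relation.
by right; left; exists x, m, n.
Qed.

Lemma tensZl a (x : X) (m : M) : tens (a *: x) m = a *: tens x m.
Proof.
apply/eqP; rewrite -subr_eq0 /tens -linearZ_LR -linearB; apply/eqP/qproj_relation.
by right; right; left; exists a, x, m.
Qed.

Lemma tens_hecke (x : X) (h : H) (m : M) : tens ((h : rep_end X) x) m = tens x (h *: m).
Proof.
apply/eqP; rewrite -subr_eq0 /tens -linearB; apply/eqP/qproj_relation.
by right; right; right; exists x, h, m.
Qed.

Lemma tensor_hom_ext (V : smooth_rep k G) (f g : rep_hom (F_rep M) V) :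
  (forall x m, f (tens x m) = g (tens x m)) -> f = g.
Proof.
move=> fg; apply: rep_ext => t; have [u <-] := qproj_surj t.
have piE (h : rep_hom (F_rep M) V) : linear (fun u => h (pi u)).
  by move=> a v w; rewrite !linearP.
have [f' f'E] := ex_linear (piE f); have [g' g'E] := ex_linear (piE g).
rewrite -f'E -g'E; apply: free_mod_hom_ext => -[x m].
by rewrite f'E g'E; exact: fg.
Qed.

(** [f] is the adjoint of [b]; it is balanced over [H] because [H] acts on [V^I = Hom_G(X, V)] by
    precomposition. *)
Lemma tensor_universal (V : smooth_rep k G) (b : {linear M -> inv V}) :
  exists f : rep_hom (F_rep M) V, forall x m, f (tens x m) = frob (b m) x.
Proof.
have [f fE] := free_mod_universal (fun z : X * M => frob (b z.2) z.1 : V).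
have fgen x m : f (tensor_gen x m) = frob (b m) x by rewrite /tensor_gen fE.
have frel u : submod_span (@tensor_relations k p G I M) u -> f u = 0.
  apply: (_ : _ -> lin_kernel f u); apply=> r /=.
  case=> [[x [y [m ->]]]|[[x [m [n ->]]]|[[a [x [m ->]]]|[x [h [m ->]]]]]];
    rewrite !linearB ?linearZ_LR /= !fgen.
  - by rewrite linearD addrAC addrK subrr.
  - by rewrite linearD frobD /= addrAC addrK subrr.
  - by rewrite linearZ_LR scalerN subrr.
  - by rewrite linearZ_LR frob_hecke_act subrr.
have [|f' f'E] := @lin_factor _ _ _ _ pi f (@qproj_surj _ _ _).
  move=> u; rewrite -(linear0 pi) => /qprojE; rewrite subr0; exact: frel.
have f'G g t : f' (tensor_act g t) = act g (f' t).
  have [u <-] := qproj_surj t; rewrite tensor_act_proj !f'E.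
  have := @free_mod_hom_ext k _ V (lin_comp f (free_act g))
    (lin_comp (act g : {linear V -> V}) f); apply=> -[x m].
  by rewrite /= -/(tensor_gen x m) free_act_gen !fgen rep_equiv.
exists (@RepHom k G (F_rep M) V f' f'G) => x m.
by rewrite -fgen -f'E.
Qed.

(** The unit of the adjunction: [m] goes to the invariant vector corresponding to
    [x |-> tens x m]. *)
Lemma tensor_unit : exists e : {linear M -> inv (F_rep M)},
  forall x m, frob (e m) x = tens x m.
Proof.
have /choice[t tE] (m : M) : exists t : rep_hom X (F_rep M), forall x, t x = tens x m.
  apply: ex_rep_hom => [a x y|g x]; first by rewrite tensDl tensZl.
  exact/esym/tensor_act_tens.
have eI m i : (I : set G) i -> act i (tens (indicator k I) m : F_rep M) = tens (indicator k I) m.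
  by move=> Ii; rewrite -[LHS]/(tensor_act _ _) tensor_act_tens indicator_fixed.
pose e m : inv (F_rep M) := in_smod (S := inv_submod I (F_rep M)) (eI m).
have eE m : frob (e m) = t m by apply: ind_hom_ext; rewrite frob_indicator tE.
have [|e' e'E] := @ex_linear H M (inv (F_rep M)) e.
  move=> h m n; apply: frob_inj; rewrite frobD frobZ !eE; apply: rep_ext => x.
  by rewrite tE tensDr -tens_hecke -!tE.
by exists e' => x m; rewrite e'E eE tE.
Qed.
End Module.

(** The universal properties of [F] of the free module and of [XS S] give maps [b] and [a] between
    them, and [b a = id] is checked on generators. *)
Lemma I_projective_XS (S : choiceType) : I_projective I (XS k I S).
Proof.
exists (freemod H S); split; first exact: projective_free.
have [u [u_bij uE]] := inv_XS_free k I S.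
have [b bE] := tensor_universal u.
have [e eE] := tensor_unit (freemod H S).
have [a aE] := XS_universal (fun s => e (free_gen H s)).
apply: (@direct_summand_retract _ _ _ _ a b) => x.
have : rep_comp b a = rep_id _; last first.
  by move/(congr1 (fun h : rep_hom (XS k I S) (XS k I S) => h x)).
apply: XS_hom_ext => s.
by rewrite /= aE eE bE uE frob_XS_gen.
Qed.

(** The projective module [Q] is a retract of the free module on its elements, and [F] of the latter
    is [XS Q]; the retraction is assembled from [tensor_universal] and [XS_universal]. *)
Lemma I_projective_retract (P : smooth_rep k G) : I_projective I P ->
  exists (S : choiceType) (a : rep_hom P (XS k I S)) (b : rep_hom (XS k I S) P),
    rep_comp b a = rep_id P.
Proof.
move=> [Q [projQ /retract_direct_summand[i [r ri]]]].
have [q q_onto] := free_cover Q; have [s sK] := projQ _ _ q idfun q_onto.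
have [u [u_bij uE]] := inv_XS_free k I Q.
have [e eE] := tensor_unit Q.
have [b bE] := XS_universal (fun m : Q => e (q (free_gen H m))).
have [a aE] := tensor_universal (lin_comp u s).
exists Q, (rep_comp a i), (rep_comp r b).
have buE : lin_comp (inv_map I b) u =1 lin_comp e q.
  by apply: free_hom_ext => m; rewrite /= uE; apply: inv_ext; rewrite inv_mapE bE frob_indicator.
have ba : rep_comp b a = rep_id (F_rep Q).
  apply: tensor_hom_ext => x m; rewrite /= aE.
  have -> : b (frob (lin_comp u s m) x) = frob (inv_map I b (u (s m))) x.
    by rewrite frob_inv_map.
  have /= -> := buE (s m); have /= -> := sK m; exact: eE.
apply: rep_ext => v /=; rewrite -[RHS]ri; congr (r _).
exact: (congr1 (fun h : rep_hom (F_rep Q) (F_rep Q) => h (i v)) ba).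
Qed.

(** An invariant vector has coordinates in [H] indexed by [T * S], finitely supported for each [t];
    this finiteness passes to coefficients supported where the [d j] are. *)
Lemma flat_inv_prod (T : Type) (S : choiceType) : left_noetherian H^c ->
  flat (inv (prod_rep T (XS k I S))).
Proof.
move=> noeH; pose P := prod_rep T (XS k I S).
have /choice[c cE] (s : S) := XS_coord k I s.
have [|C CE] := @ex_linear H (inv P) (T * S -> H^o)
    (fun w z => c z.2 (inv_map I (prod_eval_rep (XS k I S) z.1) w)).
  by move=> h v w; apply/funext => z; rewrite !linearP.
have C0 w t s : C w (t, s) = 0 <-> fs_fun (val (inv_val w) t) s = 0.
  rewrite CE cE; split=> [w0|w0].
    have := frob_indicator (inv_map I (fs_eval_rep X s) (inv_map I (prod_eval_rep _ t) w)).
    by rewrite w0 => wE; exact: (esym wE).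
  by apply: ind_hom_ext; rewrite frob_indicator.
apply: (flat_coordinates (c := C)) => //.
  apply: lin_inj0 => w w0; apply: inv_ext; apply/val_inj/funext => t; apply: fs_ext => s.
  by apply/C0; rewrite w0.
move=> a d z dz.
have zf t : fs_set (fun s => (z (t, s) : rep_end X) (indicator k I)).
  have : finite_set (\bigcup_(j in [set: 'I_a])
      [set s | fs_fun (val (inv_val (d j)) t) s != 0]).
    by apply: bigcup_finite => [|j _]; [exact: finite_finset|exact: fs_finite].
  apply: sub_finite_set => s /= zs; apply: contrapT => ds.
  move/eqP: zs; apply; rewrite dz // => j; apply/C0/eqP/negPn/negP => djs.
  by apply: ds; exists j.
pose u t : XS k I S := in_smod (S := Submod (@fs0 _ _ _) (@fsD _ _ _) (@fsZ _ _ _)) (zf t).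
have uI t i : (I : set G) i -> act i (u t) = u t.
  move=> Ii; apply: fs_ext => s.
  transitivity ((z (t, s) : rep_end X) (act i (indicator k I))).
    exact/esym/(rep_equiv (z (t, s) : rep_end X)).
  by rewrite indicator_fixed.
(* A family of invariant vectors is smooth since the open subgroup [I] fixes all of them at once. *)
have uS : smooth_family u.
  have : nbhs (1%g : G) I.
    by apply: open_nbhs_nbhs; split; [exact: opengrp_open|exact: opengrp1].
  by rewrite /smooth_family; apply: filterS => i Ii t; apply: uI.
have [|w wE] := @ex_inv k p G I P (in_smod (S := smooth_submod T (XS k I S)) uS).
  by move=> i Ii; apply/val_inj/funext => t; apply: uI.
exists w; apply/funext => -[t s]; rewrite CE cE; apply: ind_hom_ext.
rewrite frob_indicator !inv_mapE wE //.
Qed.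
End TensorUniversal.

(** * Homotopies *)

Section GorensteinWeakEquivalences.
Context (R : pzRingType).
Implicit Types K M N P : lmodType R.

Lemma qproj_eq0 M (S : submod M) x : qproj S x = 0 <-> S x.
Proof.
rewrite -(linear0 (qproj S)); split=> [/qprojE|Sx]; first by rewrite subr0.
by apply/qprojE; rewrite subr0.
Qed.

Lemma gproj_weq_onto M N (f : {linear M -> N}) : onto f ->
  finite_projective_dimension (smod (lin_kernel f)) -> @gproj_weq R M N f.
Proof.
move=> f_onto fpdK; exists M, (lin_id M), f; split=> //; first exact: linear_ext.
split=> //; apply: projective_zero => x; have [y <-] := qproj_surj x.
by apply/qproj_eq0; exists y.
Qed.

Lemma gproj_weq_split_mono M N P (f : {linear M -> N}) (g : {linear N -> P}) :
  ses f g -> projective P -> @gproj_weq R M N f.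
Proof.
move=> [f_inj g_onto fg] projP; exists N, f, (lin_id N); split; [exact: linear_ext| |].
  split=> //.
  have [|a aE] := @lin_factor _ _ _ _ (qproj (lin_image f)) g (@qproj_surj _ _ _).
    by move=> x /qproj_eq0 fx; apply/fg.
  have [s sK] := projP _ _ g idfun g_onto.
  apply: (projective_retract (a := a) (b := lin_comp (qproj (lin_image f)) s)) => //.
  move=> y; have [x <-] := qproj_surj y; rewrite aE /=.
  apply/eqP; rewrite -subr_eq0 -linearB; apply/eqP/qproj_eq0/fg.
  by rewrite linearB; have /= -> := sK (g x); rewrite subrr.
split; first by move=> x; exists x.
by apply: fpd_zero => x; apply: val_inj; exact: (smodP x).
Qed.

(* A cover [Q -> M] restricts to one of [K] by the kernel of [Q -> P], which is
   projective, and both covers have the same kernel. *)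
Lemma fpd_kernel_projective K M P (i : {linear K -> M}) (e : {linear M -> P}) :
  ses i e -> projective P -> finite_projective_dimension M ->
  finite_projective_dimension K.
Proof.
move=> [i_inj e_onto ie] projP /fpd_cover[Q [q [projQ q_onto fpdQ]]].
pose f := lin_comp e q.
have f_onto : onto f by move=> y; have [x <-] := e_onto y; have [z <-] := q_onto x; exists z.
have [s sK'] := projP _ _ f idfun f_onto; have sK y : f (s y) = y by exact: sK' y.
pose L := smod (lin_kernel f).
have projL : projective L.
  have [|r rE] := @lin_lift R Q L _ (smod_incl _) (idfun \- lin_comp s f) (@smod_incl_inj _ _ _).
    move=> x; have kx : lin_kernel f (x - s (f x)).
      by have := linearB f x (s (f x)); rewrite sK subrr.
    by exists (in_smod kx).
  apply: (projective_retract (a := smod_incl _) (b := r)) projQ => x.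
  apply: (@smod_incl_inj _ _ (lin_kernel f)); rewrite rE /=.
  by have /= -> := smodP x; rewrite linear0 subr0.
have [|q' q'E] := @lin_lift R L K _ i (lin_comp q (smod_incl (lin_kernel f))) i_inj.
  by move=> x; apply/ie; exact: (smodP x).
have [|j jE] := @lin_lift R (smod (lin_kernel q)) L _ (smod_incl (lin_kernel f))
    (smod_incl (lin_kernel q)) (@smod_incl_inj _ _ _).
  move=> x; have kx : lin_kernel f (val x).
    by have qx := smodP x; rewrite /= in qx; rewrite /= qx linear0.
  by exists (in_smod kx).
apply: (fpd_ses (i := j) (e := q')) fpdQ => //; split.
- by move=> x y xy; apply: (@smod_incl_inj _ _ (lin_kernel q)); rewrite -!jE xy.
- move=> y; have [z zE] := q_onto (i y).
  have kz : lin_kernel f z by rewrite /= zE; apply/ie; exists y.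
  by exists (in_smod kz); apply: i_inj; rewrite q'E.
- move=> x; split=> [x0|[y <-]].
    have qx : lin_kernel q (val x) by rewrite /= -[q _]q'E x0 linear0.
    by exists (in_smod qx); apply: (@smod_incl_inj _ _ (lin_kernel f)); rewrite jE.
  by apply: i_inj; rewrite q'E linear0; exact: etrans (congr1 q (jE y)) (smodP y).
Qed.

(** For [f = q i] the sequence [0 -> ker f -> ker q -> coker i -> 0] is exact, with [coker i]
    projective. *)
Lemma gproj_weq_kernel M N (f : {linear M -> N}) : onto f -> @gproj_weq R M N f ->
  finite_projective_dimension (smod (lin_kernel f)).
Proof.
move=> f_onto [E [i [q [fE [i_inj projC] [q_onto fpdK]]]]]; simpl in E, i, q.
have {}fE x : f x = q (i x) by rewrite fE.
pose e := lin_comp (qproj (lin_image i)) (smod_incl (lin_kernel q)).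
have [|j jE] := @lin_lift R (smod (lin_kernel f)) (smod (lin_kernel q)) _
    (smod_incl (lin_kernel q)) (lin_comp i (smod_incl (lin_kernel f))) (@smod_incl_inj _ _ _).
  move=> x; have kx : lin_kernel q (i (val x)) by rewrite /= -fE; exact: (smodP x).
  by exists (in_smod kx).
apply: (fpd_kernel_projective (i := j) (e := e)) fpdK => //; split.
- by move=> x y /(congr1 (smod_incl _)); rewrite !jE => /i_inj/smod_incl_inj.
- move=> c; have [x <-] := qproj_surj c; have [y yE] := f_onto (q x).
  have kx : lin_kernel q (x - i y) by rewrite /= linearB -fE yE subrr.
  by exists (in_smod kx); apply/qprojE; exists (- y); rewrite /= addrAC subrr add0r linearN.
- move=> x; split=> [/qproj_eq0[y yE]|[y <-]].
    have ky : lin_kernel f y by rewrite /= fE yE; exact: (smodP x).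
    by exists (in_smod ky); apply: (@smod_incl_inj _ _ (lin_kernel q)); rewrite jE.
  by apply/qproj_eq0; exists (val y); rewrite jE.
Qed.

(** For [r = q i] the map [(1 - r c) q] induces an exact sequence
    [0 -> ker q -> coker i -> ker c -> 0], with [coker i] projective. *)
Lemma gproj_weq_retraction_kernel M N (r : {linear M -> N}) (c : {linear N -> M}) :
  (forall x, c (r x) = x) -> @gproj_weq R M N r ->
  finite_projective_dimension (smod (lin_kernel c)).
Proof.
move=> rK [E [i [q [rE [i_inj projC] [q_onto fpdK]]]]]; simpl in E, i, q.
have {}rE x : r x = q (i x) by rewrite rE.
have cK x : lin_kernel c (x - r (c x)) by rewrite /= linearB rK subrr.
have [|n nE] := @lin_lift R N (smod (lin_kernel c)) _ (smod_incl _) (idfun \- lin_comp r c)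
    (@smod_incl_inj _ _ _).
  by move=> x; exists (in_smod (cK x)).
have n0 x : n x = 0 <-> x = r (c x).
  split=> [x0|xE].
    by have := nE x; rewrite x0 linear0 /= => /esym/eqP; rewrite subr_eq0 => /eqP.
  by apply: (@smod_incl_inj _ _ (lin_kernel c)); rewrite nE linear0 /= -xE subrr.
have [|e eE] := @lin_factor _ _ _ _ (qproj (lin_image i)) (lin_comp n q) (@qproj_surj _ _ _).
  by move=> x /qproj_eq0[y <-]; apply/n0; rewrite -rE rK.
apply: (fpd_ses (i := lin_comp (qproj (lin_image i)) (smod_incl (lin_kernel q))) (e := e))
  fpdK => //; split.
- apply: lin_inj0 => x /qproj_eq0[y yE].
  have qx : q (val x) = 0 := smodP x.
  have y0 : y = 0 by rewrite -[y]rK rE yE qx linear0.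
  by apply: val_inj; rewrite -[LHS]yE y0 linear0.
- move=> y; have [x xE] := q_onto (val y); exists (qproj _ x); rewrite eE.
  apply: (@smod_incl_inj _ _ (lin_kernel c)); rewrite nE /= xE.
  by have /= -> := smodP y; rewrite linear0 subr0.
- move=> z; have [x <-] := qproj_surj z; rewrite eE; split=> [/n0 xE|[y yE]].
    have kx : lin_kernel q (x - i (c (q x))) by rewrite /= linearB -rE -xE subrr.
    exists (in_smod kx); apply/qprojE; exists (- c (q x)).
    by rewrite /= addrAC subrr add0r linearN.
  refine (etrans (esym (eE x)) (etrans (congr1 e (esym yE)) _)).
  by rewrite eE /=; have /= -> := smodP y; rewrite linear0.
Qed.
End GorensteinWeakEquivalences.

(** * Biproducts of representations *)

Section PairMaps.
Context (k : fieldType) (G : topologicalGroupType).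
Implicit Types U V W Y : smooth_rep k G.

Lemma pair_in U V W (f : rep_hom U V) (g : rep_hom U W) :
  exists h : rep_hom U (pair_rep V W), forall u, h u = (f u, g u).
Proof.
apply: ex_rep_hom => [a u v|x u]; first by rewrite !linearP.
by rewrite !rep_equiv.
Qed.

Lemma pair_out V W Y (f : rep_hom V Y) (g : rep_hom W Y) :
  exists h : rep_hom (pair_rep V W) Y, forall z, h z = f z.1 + g z.2.
Proof.
apply: ex_rep_hom => [a z t|x z]; first by rewrite /= !linearP scalerDr addrACA.
by rewrite /= !rep_equiv linearD.
Qed.

Lemma pair_is_product V W (p : rep_hom (pair_rep V W) V) (q : rep_hom (pair_rep V W) W) :
  (forall z, p z = z.1) -> (forall z, q z = z.2) -> @is_product (Rep k G) V W _ p q.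
Proof.
move=> pE qE U u v; have [h hE] := pair_in u v; exists h; split.
  by split; apply: rep_ext => x; rewrite /= ?pE ?qE hE.
move=> h' [uE vE]; apply: rep_ext => x; rewrite hE -uE -vE /= pE qE.
by case: (h' x).
Qed.

Lemma pair_is_coproduct V W (i : rep_hom V (pair_rep V W)) (j : rep_hom W (pair_rep V W)) :
  (forall v, i v = (v, 0)) -> (forall w, j w = (0, w)) -> @is_coproduct (Rep k G) V W _ i j.
Proof.
move=> iE jE Y u v; have [h hE] := pair_out u v; exists h; split.
  by split; apply: rep_ext => x; rewrite /= hE ?iE ?jE /= linear0 ?addr0 ?add0r.
move=> h' [uE vE]; apply: rep_ext => -[x y]; rewrite hE -uE -vE /= iE jE -linearD.
by congr (h' (_, _)); rewrite /= ?addr0 ?add0r.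
Qed.
End PairMaps.

(** * [H] as an algebra over [k] *)

Section HeckeScalars.
Context (k : fieldType) (p : nat) (G : topologicalGroupType).
Context (I : open_pro_p_subgroup p G).
Notation X := (ind_rep k I).

Fact scalar_equiv (a : k) g (x : X) : a *: act g x = act g (a *: x).
Proof. by rewrite linearZ_LR. Qed.
Definition hecke_scalar (a : k) : hecke k I :=
  @RepHom k G X X (a \*: idfun) (scalar_equiv a).

Fact hecke_scalar_zmod : zmod_morphism hecke_scalar.
Proof. by move=> a b; apply: rep_ext => x /=; rewrite scalerBl. Qed.
Fact hecke_scalar_monoid : monoid_morphism hecke_scalar.
Proof.
split=> [|a b]; apply: rep_ext => x /=; first exact: scale1r.
by rewrite scalerA mulrC.
Qed.
HB.instance Definition _ :=
  GRing.isZmodMorphism.Build k (hecke k I) hecke_scalar hecke_scalar_zmod.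
HB.instance Definition _ :=
  GRing.isMonoidMorphism.Build k (hecke k I) hecke_scalar hecke_scalar_monoid.

Lemma hecke_enough_injectives : enough_injectives (hecke k I).
Proof. exact: (algebra_enough_injectives (hecke_scalar : {rmorphism k -> hecke k I})). Qed.
End HeckeScalars.

(** * Maps out of a cofibrant object *)

Section Cofibrant.
Context (k : fieldType) (p : nat) (G : topologicalGroupType).
Context (I : open_pro_p_subgroup p G).
Implicit Types (W Y Z N : smooth_rep k G) (S : choiceType).

Notation H := (hecke k I).
Notation inv V := (invariants I V).
Notation XS := (XS k I).

Lemma I_fib_weq Y Z (q : rep_hom Y Z) : onto (inv_map I q) ->
  finite_projective_dimension (smod (lin_kernel (inv_map I q))) ->
  @I_fib k p G I Y Z q /\ @I_weq k p G I Y Z q.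
Proof. by move=> q_onto fpdK; split=> //; exact: gproj_weq_onto. Qed.

Section CofibrantObject.
Context (V : smooth_rep k G).
Hypothesis cofV : @cofibrant (Rep k G) (I_gproj_model k I) V.

(** The cofibration into [V] starts at an initial object, so any [v] completes to a commutative
    lifting square. *)
Lemma cofibrant_lift Y Z (q : rep_hom Y Z) (v : rep_hom V Z) :
  onto (inv_map I q) -> finite_projective_dimension (smod (lin_kernel (inv_map I q))) ->
  exists u : rep_hom V Y, rep_comp q u = v.
Proof.
move=> q_onto fpdK; have [fibq weqq] := I_fib_weq q_onto fpdK.
have [O [z [initO cofz]]] := cofV.
have [y _] := initO Y; have [o [_ oE]] := initO Z.
have [|h [_ hE]] := cofz Y Z q fibq weqq y v; last by exists h.
exact: etrans (esym (oE _ Logic.I)) (oE _ Logic.I).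
Qed.

Lemma cofibrant_factor N (v : rep_hom V N) : finite_projective_dimension (inv N) ->
  exists S (a : rep_hom V (XS S)) (b : rep_hom (XS S) N), rep_comp b a = v.
Proof.
move=> /XS_cover[S [b [b_onto fpdK]]].
by have [a aE] := cofibrant_lift v b_onto fpdK; exists S, a, b.
Qed.

(** Every [v] meets finitely many coordinates, so [V * nat] is large enough to
    index those met by a given map from [V]. *)
Lemma bound_coordinates S (a : rep_hom V (XS S)) :
  exists (a' : rep_hom V (XS (V * nat)%type)) (b : rep_hom (XS (V * nat)%type) (XS S)),
    rep_comp b a' = a.
Proof.
pose supp v := [set s | fs_fun (a v) s != 0].
pose met := [set s | exists v, supp v s].
pose L v := map Some (fset_set (supp v) : seq S).
(* The [n]-th coordinate met by [v] is [at_ (v, n)], with [None] past the end of the finite list. *)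
pose at_ (c : V * nat) := nth None (L c.1) c.2.
have /choice[idx idxE] s : exists c, met s -> at_ c = Some s.
  have [[v vs]|nm] := pselect (met s); last by exists (0, 0%N).
  exists (v, index (Some s) (L v)) => _; apply: nth_index; apply: map_f.
  by rewrite in_fset_set ?inE //; exact: fs_finite.
(* Only the chosen code [idx s] carries the coordinate [s], which keeps the support of [a1 v]
   finite. *)
pose a1 v c := if at_ c is Some s then if idx s == c then fs_fun (a v) s else 0 else 0.
have a1f v : fs_set (a1 v).
  apply: (sub_finite_set _ (finite_image idx (fs_finite (a v)))) => c /=.
  rewrite /a1; case: (at_ c) => [s|]; last by rewrite eqxx.
  by case: (idx s =P c) => [<- as0|_]; [exists s|rewrite eqxx].
have [||a' a'E] := @ex_rep_hom k G V (XS (V * nat)%type)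
    (fun v => in_smod (S := Submod (@fs0 _ _ _) (@fsD _ _ _) (@fsZ _ _ _)) (a1f v)).
- move=> r u v; apply: fs_ext => c; rewrite fs_funP /fs_fun /= /a1.
  case: (at_ c) => [s|]; last by rewrite scaler0 addr0.
  by case: eqP => _; rewrite ?linearP ?fs_funP // scaler0 addr0.
- move=> g v; apply: fs_ext => c; rewrite [RHS]fs_actE /fs_fun /= /a1.
  case: (at_ c) => [s|]; last by rewrite linear0.
  by case: eqP => _; rewrite ?linear0 // rep_equiv.
pose b1 (u : XS (V * nat)%type) s := if `[< met s >] then fs_fun u (idx s) else 0.
have b1f u : fs_set (b1 u).
  apply: (sub_finite_set (B := Some @^-1` (at_ @` [set c | fs_fun u c != 0]))).
    move=> s /=; rewrite /b1; case: asboolP => [ms us|]; last by rewrite eqxx.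
    by exists (idx s) => //; exact: idxE.
  apply: finite_preimage; last exact/finite_image/fs_finite.
  by move=> s t _ _ [].
have [||b bE] := @ex_rep_hom k G (XS (V * nat)%type) (XS S)
    (fun u => in_smod (S := Submod (@fs0 _ _ _) (@fsD _ _ _) (@fsZ _ _ _)) (b1f u)).
- move=> r u v; apply: fs_ext => s; rewrite fs_funP /fs_fun /= /b1.
  by case: asboolP; rewrite ?fs_funP // scaler0 addr0.
- move=> g u; apply: fs_ext => s; rewrite [RHS]fs_actE /fs_fun /= /b1.
  by case: asboolP; rewrite ?linear0.
exists a', b; apply: rep_ext => v; apply: fs_ext => s.
rewrite /= bE /fs_fun /= /b1; case: asboolP => [ms|nms].
  by rewrite a'E /fs_fun /= /a1 idxE // eqxx.
by apply/esym/eqP/negPn/negP => vs; apply: nms; exists v.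
Qed.

(** Modulo [bound_coordinates] it suffices to factor through one object [T] the
    diagonal map to the product of all maps to a fixed [XS S]; products of free
    [H]-modules are flat, so [T^I] has finite projective dimension. *)
Lemma cofibrant_preenvelope : gorenstein_ring H ->
  exists S (j : rep_hom V (XS S)), forall S' (a : rep_hom V (XS S')),
    exists b : rep_hom (XS S) (XS S'), rep_comp b j = a.
Proof.
move=> [lnoeH rnoeH injH _].
pose B := XS (V * nat)%type; pose T := prod_rep (rep_hom V B) B.
have jS v : smooth_family (fun t : rep_hom V B => t v).
  move: (nbhs1_stab v); rewrite /smooth_family; apply: filterS => g gv t.
  by transitivity (t (act g v)); [exact/esym/rep_equiv|rewrite gv].
have [||j0 j0E] := @ex_rep_hom k G V T
    (fun v => in_smod (S := smooth_submod (rep_hom V B) B) (jS v)).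
- by move=> r u v; apply/val_inj/funext => t; rewrite /= linearP.
- by move=> g v; apply/val_inj/funext => t; exact: rep_equiv.
have fpdT : finite_projective_dimension (inv T).
  apply: flat_fpd => //; first exact: hecke_enough_injectives.
  exact: flat_inv_prod.
(* The map [a'] is a component of [j0], so [c] followed by the projection to that component extends
   it along [j]. *)
have [S [j [c cj]]] := cofibrant_factor j0 fpdT; exists S, j => S' a.
have [a' [b ba]] := bound_coordinates a.
exists (rep_comp b (rep_comp (prod_eval_rep B a') c)).
rewrite -ba; apply: rep_ext => v /=; congr (b _).
have := congr1 (fun h : rep_hom V T => h v) cj; rewrite /= j0E => ->.
by [].
Qed.

Section Preenvelope.
Context (S : choiceType) (j : rep_hom V (XS S)).
Hypothesis jP : forall S' (a : rep_hom V (XS S')),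
  exists b : rep_hom (XS S) (XS S'), rep_comp b j = a.

(** Lift [v] to [w]. The error [u - w j] lands in [ker q], hence factors through some [XS S'] and
    extends along [j]; adding the extension to [w] does not change its composite with [q]. *)
Lemma preenvelope_lifting Y Z (q : rep_hom Y Z) (u : rep_hom V Y) (v : rep_hom (XS S) Z) :
  onto (inv_map I q) -> finite_projective_dimension (smod (lin_kernel (inv_map I q))) ->
  rep_comp q u = rep_comp v j ->
  exists h : rep_hom (XS S) Y, rep_comp h j = u /\ rep_comp q h = v.
Proof.
move=> q_onto fpdK qu; have [w wE] := XS_lift v q_onto.
have qd x : q ((u - rep_comp w j : rep_hom V Y) x) = 0.
  have := congr1 (fun h : rep_hom V Z => h x) qu; rewrite -wE /= => qux.
  by rewrite linearB qux subrr.
have [d dE] := ker_lift qd.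
have /(cofibrant_factor d)[S' [a [b ba]]] := (fpd_inv_ker I q).1 fpdK.
have [c cj] := jP a.
exists (w + rep_comp (ker_incl q) (rep_comp b c)); split; apply: rep_ext => x /=.
  have := congr1 (fun h : rep_hom V Y => h x) dE; rewrite -ba -cj /= => ->.
  by rewrite addrC subrK.
rewrite linearD; have /= -> := smodP (b (c x)).
by rewrite addr0 -wE.
Qed.
End Preenvelope.
End CofibrantObject.
End Cofibrant.

(** * Homotopies and factorizations of the difference *)

Section Homotopy.
Context (k : fieldType) (p : nat) (G : topologicalGroupType).
Context (I : open_pro_p_subgroup p G) (V W : smooth_rep k G).
Hypothesis gorH : gorenstein_ring (hecke k I).
Hypothesis cofV : @cofibrant (Rep k G) (I_gproj_model k I) V.

Notation inv V := (invariants I V).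
Notation XS := (XS k I).
Notation model := (I_gproj_model k I).

Lemma right_homotopic_factor (f g : rep_hom V W) : @right_homotopic (Rep k G) model V W f g ->
  exists (S : choiceType) (a : rep_hom V (XS S)) (b : rep_hom (XS S) W),
    g - f = rep_comp b a.
Proof.
move=> [P [r [p0 [p1 [K [[T [q0 [q1 [q [_ [weq_r _] _ [p0r p1r]]]]]] <- <-]]]]]].
simpl in P, r, p0, p1, K.
have rK0 v : p0 (r v) = v by exact: (congr1 (fun h : rep_hom W W => h v) p0r).
have rK1 v : p1 (r v) = v by exact: (congr1 (fun h : rep_hom W W => h v) p1r).
have fpdN : finite_projective_dimension (inv (ker_rep p0)).
  apply/fpd_inv_ker; apply: gproj_weq_retraction_kernel weq_r => v.
  by apply: inv_ext; rewrite !inv_mapE rK0.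
(* The component of [K] in [ker p0]; [p1] maps it to [g - f]. *)
have qd x : p0 ((K - rep_comp r (rep_comp p0 K) : rep_hom V P) x) = 0.
  by rewrite linearB /= rK0 subrr.
have [d dE] := ker_lift qd.
have [S [a [b ba]]] := cofibrant_factor cofV d fpdN.
exists S, a, (rep_comp p1 (rep_comp (ker_incl p0) b)); apply: rep_ext => v.
have := congr1 (fun h : rep_hom V P => h v) dE; rewrite -ba /= => ->.
by rewrite linearB rK1.
Qed.

Lemma factor_right_homotopic S (f g : rep_hom V W) (a : rep_hom V (XS S))
    (b : rep_hom (XS S) W) :
  g - f = rep_comp b a -> @right_homotopic (Rep k G) model V W f g.
Proof.
move=> gf; pose Q := XS (inv W).
(* The generator indexed by [w] is sent to [w], so [t] is onto on invariants. *)
have [t tE] := @XS_universal k p G I (inv W) W id.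
have t_onto : onto (inv_map I t).
  by move=> w; exists (XS_gen k I w); apply: inv_ext; rewrite inv_mapE tE frob_indicator.
have [c tc] := XS_lift b t_onto.
pose idW : rep_hom W W := rep_id W; pose idQ : rep_hom Q Q := rep_id Q.
have [r rE] := pair_in idW (0 : rep_hom W Q).
have [p0 p0E] := pair_out idW (0 : rep_hom Q W).
have [p1 p1E] := pair_out idW t.
have [s sE] := pair_out (0 : rep_hom W Q) idQ.
have [q0 q0E] := pair_out idW (0 : rep_hom W W).
have [q1 q1E] := pair_out (0 : rep_hom W W) idW.
have [q qE] := pair_in p0 p1.
have [K KE] := pair_in f (rep_comp c a).
exists (pair_rep W Q), r, p0, p1, K; split; last first.
- apply: rep_ext => v /=; rewrite p1E KE /=.
  have := congr1 (fun h : rep_hom _ _ => h (a v)) tc; rewrite /= => ->.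
  by have := congr1 (fun h : rep_hom _ _ => h v) gf; rewrite /= => <-; rewrite addrC subrK.
- by apply: rep_ext => v /=; rewrite p0E KE /= addr0.
exists (pair_rep W W), q0, q1, q; split.
- by apply: pair_is_product => z; rewrite ?q0E ?q1E /= ?addr0 ?add0r.
- split.
    (* On invariants [r] is a split monomorphism whose cokernel is the projective module [Q^I]. *)
    apply: (@gproj_weq_split_mono _ _ _ _ (inv_map I r) (inv_map I s)); last first.
      exact: projective_inv_XS.
    split.
    + move=> u v /(congr1 (@inv_val _ _ _ _ _)); rewrite !inv_mapE !rE => -[uv].
      exact: (inv_ext uv).
    + move=> x; have [|y yE] := @ex_inv k p G I (pair_rep W Q) (0, inv_val x).
        by move=> i Ii; rewrite -[LHS]/(_, _) /= linear0 (inv_valP x Ii).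
      by exists y; apply: inv_ext; rewrite inv_mapE yE sE /= add0r.
    + move=> x; split=> [/(congr1 (@inv_val _ _ _ _ _))|[y <-]].
        rewrite inv_mapE sE /= add0r => x2.
        exists (inv_map I p0 x); apply: inv_ext; rewrite !inv_mapE rE p0E /= addr0.
        by case: (inv_val x) x2 => x1 y /= ->.
      by apply: inv_ext; rewrite !inv_mapE sE rE /= addr0.
  (* The pair [(w0, w1)] is the image of [(w0, x)] when [t x = w1 - w0]. *)
  move=> w; have [x xE] := t_onto (inv_map I q1 w - inv_map I q0 w).
  have [|y yE] := @ex_inv k p G I (pair_rep W Q) (inv_val (inv_map I q0 w), inv_val x).
    by move=> i Ii; rewrite -[LHS]/(_, _) /= (inv_valP (inv_map I q0 w) Ii) (inv_valP x Ii).
  exists y; apply: inv_ext; rewrite inv_mapE yE qE p0E p1E /= addr0.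
  rewrite -(inv_mapE t x) xE [inv_val (_ - _)]/(inv_val _ - inv_val _) addrC subrK !inv_mapE.
  by rewrite q0E q1E /= addr0 add0r -surjective_pairing.
- by split; apply: rep_ext => z /=; rewrite ?q0E ?q1E qE /= ?addr0 ?add0r.
- by split; apply: rep_ext => w /=; rewrite ?p0E ?p1E rE /= ?linear0 addr0.
Qed.

Lemma factor_left_homotopic S (f g : rep_hom V W) (a : rep_hom V (XS S))
    (b : rep_hom (XS S) W) :
  g - f = rep_comp b a -> @left_homotopic (Rep k G) model V W f g.
Proof.
move=> gf; have [S' [j jP]] := cofibrant_preenvelope cofV gorH.
have [c cj] := jP _ a; pose Q := XS S'.
pose idV : rep_hom V V := rep_id V; pose idQ : rep_hom Q Q := rep_id Q.
have [i0 i0E] := pair_in idV (0 : rep_hom V Q).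
have [i1 i1E] := pair_in idV j.
have [s sE] := pair_out idV (0 : rep_hom Q V).
have [K KE] := pair_out f (rep_comp b c).
have [j0 j0E] := pair_in idV (0 : rep_hom V V).
have [j1 j1E] := pair_in (0 : rep_hom V V) idV.
have [i iE] := pair_out i0 i1.
exists (pair_rep V Q), i0, i1, s, K; split; last first.
- apply: rep_ext => v /=; rewrite KE i1E /=.
  have := congr1 (fun h : rep_hom _ _ => h v) cj; rewrite /= => ->.
  by have := congr1 (fun h : rep_hom _ _ => h v) gf; rewrite /= => <-; rewrite addrC subrK.
- by apply: rep_ext => v /=; rewrite KE i0E /= !linear0 addr0.
exists (pair_rep V V), j0, j1, i; split.
- by apply: pair_is_coproduct.
- split; last first.
    apply: gproj_weq_onto.
      move=> v; exists (inv_map I i0 v); apply: inv_ext.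
      by rewrite !inv_mapE sE i0E /= addr0.
    (* The kernel of [s] is the summand [Q], whose invariants are projective. *)
    have [i2 i2E] := pair_in (0 : rep_hom Q V) idQ.
    apply/(@fpd_kernel_iso _ _ _ _ (inv_map I i2)).
    + move=> x y /(congr1 (@inv_val _ _ _ _ _)); rewrite !inv_mapE !i2E => -[xy].
      exact: (inv_ext xy).
    + move=> x; split=> [/(congr1 (@inv_val _ _ _ _ _))|[y <-]].
        rewrite inv_mapE sE /= addr0 => x1.
        have [s2 s2E] := pair_out (0 : rep_hom V Q) idQ.
        exists (inv_map I s2 x); apply: inv_ext; rewrite !inv_mapE i2E s2E /= add0r.
        by case: (inv_val x) x1 => y x2 /= ->.
      by apply: inv_ext; rewrite !inv_mapE sE i2E /= addr0.
    exact/fpd_projective/projective_inv_XS.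
  move=> Y Z q fibq weqq u v; simpl in Y, Z, q, u, v => quv.
  have fpdK := gproj_weq_kernel fibq weqq.
  (* [V + V] is the sum of its first summand, which [i] maps identically to [V], and of the
     antidiagonal [n], on which [i] is [j]; only [j] needs a lifting argument. *)
  have [n nE] := pair_in (- idV) idV.
  have [k2 k2E] := pair_in (0 : rep_hom Q V) idQ.
  have quvE z : q (u z) = v (i z).
    exact: (congr1 (fun h : rep_hom (pair_rep V V) Z => h z) quv).
  have [|h [hj qh]] := @preenvelope_lifting _ _ _ _ _ cofV _ _ jP Y Z q (rep_comp u n)
      (rep_comp v k2) fibq fpdK.
    apply: rep_ext => x /=; rewrite quvE nE k2E iE i0E i1E /=.
    by congr (v (_, _)); rewrite /= ?addNr ?add0r.
  have hjE x : h (j x) = u (- x, x).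
    by have := congr1 (fun h : rep_hom V Y => h x) hj; rewrite /= nE.
  have qhE x : q (h x) = v (0, x).
    by have := congr1 (fun h : rep_hom Q Z => h x) qh; rewrite /= k2E.
  have [h' h'E] := pair_out (rep_comp u j0) h.
  exists h'; split; apply: rep_ext => -[x y].
    rewrite /= iE i0E i1E h'E /= j0E /= add0r hjE -linearD.
    by congr (u (_, _)); rewrite /= ?addrK ?add0r.
  rewrite /= h'E /= linearD quvE j0E iE i0E i1E qhE !linear0 -linearD.
  by congr (v (_, _)); rewrite /= ?addr0 ?add0r.
- by split; apply: rep_ext => v; rewrite /= iE ?j0E ?j1E /= !linear0 ?addr0 ?add0r.
- by split; apply: rep_ext => v; rewrite /= sE ?i0E ?i1E /= addr0.
Qed.
End Homotopy.

Theorem lemma4p21 (k : fieldType) (p : nat) (char_k : p \in [pchar k]%R)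
    (G : topologicalGroupType) (I : open_pro_p_subgroup p G)
    (gorenstein_H : gorenstein_ring (hecke k I))
    (V W : Rep k G) (cofibrant_V : cofibrant (I_gproj_model k I) V)
    (f g : rep_hom V W) :
  homotopic (I_gproj_model k I) f g <->
  exists (P : Rep k G) (a : rep_hom V P) (b : rep_hom P W),
    I_projective I P /\ (g - f)%R = rep_comp b a.
Proof.
split=> [[_ /(right_homotopic_factor cofibrant_V)[S [a [b gf]]]]|].
  by exists (XS k I S), a, b; split; [exact: I_projective_XS|].
(* As a retract, [P] can be replaced by some [XS S] in the factorization. *)
move=> [P [a [b [/I_projective_retract[S [i [r ri]]] gf]]]].
have {}gf : g - f = rep_comp (rep_comp b r) (rep_comp i a).
  rewrite gf; apply: rep_ext => v /=; congr (b _).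
  exact/esym/(congr1 (fun h : rep_hom P P => h (a v)) ri).
split; first exact: factor_left_homotopic gf.
exact: factor_right_homotopic gf.
Qed.
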